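(* Let $G$ be a finite group and $H$ a subgroup of $G$. The natural maps $\eta_{\underline R}:\underline R\to\mathrm{Res}_H^GN^{G,H}\underline R$ (for $\underline R$ an $H$-Tambara functor) and $\epsilon_{\underline R}:N^{G,H}\mathrm{Res}_H^G\underline R\to\underline R$ (for $\underline R$ a $G$-Tambara functor), defined as the additive completions of the maps $u\mapsto(G\times_HX\xrightarrow=G\times_HX,n_{\eta_X}(u))$ and $(V\xrightarrow jX,u)\mapsto t_jn_{\epsilon_V}(u)$ respectively, are the unit and counit, respectively, of an adjunction $(N^{G,H},\mathrm{Res}_H^G)$ between the category of $H$-Tambara functors and the category of $G$-Tambara functors ($N^{G,H}$ being the left adjoint).
   Context: $\mathrm{Fin}_G$ is the category of finite $G$-sets. Exponential diagrams: for $i:X\to Y$, $j:Y\to Z$ in $\mathrm{Fin}_G$ let $\prod_{i,j}X=\{(z,s): z\in Z,\ s:j^{-1}(z)\to X,\ i\circ s=\mathrm{Id}\}$ (conjugation action), $p(z,s)=z$, $e:Y\times_Z\prod_{i,j}X\to X$, $e(y,(z,s))=s(y)$. A triple $(f:A\to X,g:A\to B,h:B\to Z)$ isomorphic to $(e,\pi_2,p)$ is a distributor for $(i,j)$. A semi-Tambara functor over $G$ is a triple of functors $\underline M^*:\mathrm{Fin}_G^{op}\to\mathrm{Set}_{\ne\emptyset}$, $\underline M_*,\underline M_\star:\mathrm{Fin}_G\to\mathrm{Set}_{\ne\emptyset}$ (nonempty sets) with common object assignment $X\mapsto\underline M(X)$; write $r_f=\underline M^*(f)$, $t_f=\underline M_*(f)$,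 $n_f=\underline M_\star(f)$. One requires: $\underline M^*$ takes coproducts to products; for pullback squares with $p:P\to X$, $q:P\to Y$, $i:Y\to Z$, $j:X\to Z$, $r_jt_i=t_pr_q$ and $r_jn_i=n_pr_q$; and for each distributor $(f,g,h)$ for $(i,j)$, $n_jt_i=t_hn_gr_f$. Transfer along fold maps makes each $\underline M(X)$ a commutative monoid; $\underline M$ is a Tambara functor if these are all groups. Levelwise Grothendieck group completion is left adjoint to the inclusion of Tambara functors in semi-Tambara functors (additive completion). Restriction: $(\mathrm{Res}_H^G\underline R)(X)=\underline R(G\times_HX)$, with structure maps along $G\times_Hf$. $\eta_X:X\to\mathrm{Res}_H^G(G\times_HX)$, $x\mapsto[1,x]$, and $\epsilon_V:G\times_H\mathrm{Res}_H^GV\to V$, $[g,v]\mapsto gv$. $G\times_H\mathrm{Res}_H^GV$ is identified with $G/H\times V$ by $[g,v]\mapsto(gH,gv)$. Definition of $sN^{G,H}$: for an $H$-semi-Tambara functor $\underline R$ and $X\in\mathrm{Fin}_G$, $sN^{G,H}\underline R(X)$ is the set of isomorphism classes of pairs $(V\xrightarrow jX,u)$ with $j$ in $\mathrm{Fin}_G$, $u\in\underline R(\mathrm{Res}_H^GV)$ (isomorphisms $f:V'\to V$ over $X$ with $r_{\mathrm{Res}_H^Gf}(u)=u'$), modulo the smallest equivalence relation with $(V\xrightarrow jX,t_f(w))\sim(D_H(W,f,V)\xrightarrow{j\circ p}X,r_{e_H}(w))$ for all $H$-maps $f:W\to\mathrm{Res}_H^GV$, $w\in\underline R(W)$, where $(G\times_He_H:G/H\times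 D_H(W,f,V)\to G\times_HW,\ \pi_2,\ p:D_H(W,f,V)\to V)$ is a distributor for $(G\times_Hf:G\times_HW\to G/H\times V,\ \pi_2:G/H\times V\to V)$. Transfers are by composition, restrictions by pullback, and for $f:X\to Y$, $n_f(V\xrightarrow jX,u)=(D\xrightarrow pY,\ n_{\mathrm{Res}_H^Gk}r_{\mathrm{Res}_H^Ge}(u))$, where $(e:E\to V,k:E\to D,p:D\to Y)$ is a distributor for $(j,f)$. This is a $G$-semi-Tambara functor. For an $H$-Tambara functor $\underline R$, $N^{G,H}\underline R$ is the additive completion of $sN^{G,H}\underline R$. The displayed formulas define maps of semi-Tambara functors $\underline R\to\mathrm{Res}_H^GsN^{G,H}\underline R$ and $sN^{G,H}\mathrm{Res}_H^G\underline R\to\underline R$; $\eta_{\underline R}$ is the first composed with the completion map to $\mathrm{Res}_H^GN^{G,H}\underline R$, and $\epsilon_{\underline R}$ is the unique extension of the second to $N^{G,H}\mathrm{Res}_H^G\underline R$. *)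

(* Defs.v *)
From HB Require Import structures.
From mathcomp Require Import all_boot all_fingroup.
From mathcomp Require Import boolp.
From Stdlib Require Import Relation_Operators.

Set Implicit Arguments.
Unset Strict Implicit.
Unset Printing Implicit Defensive.

Local Open Scope quotient_scope.

Record category := Category {
  obj :> Type;
  hom : obj -> obj -> Type;
  idc : forall a, hom a a;
  compc : forall a b c, hom b c -> hom a b -> hom a c;
  comp1c : forall a b (f : hom a b), compc (idc b) f = f;
  compc1 : forall a b (f : hom a b), compc f (idc a) = f;
  compcA : forall a b c d (h : hom c d) (g : hom b c) (f : hom a b),
    compc h (compc g f) = compc (compc h g) f }.

(* [functor_on F]: the functors whose assignment on objects is [F]. *)
Record functor_on (C D : category) (F : C -> D) := FunctorOn {
  fmap : forall a b, hom a b -> hom (F a) (F b);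
  fmap1 : forall a, fmap (idc a) = idc (F a);
  fmapM : forall a b c (g : hom b c) (f : hom a b),
    fmap (compc g f) = compc (fmap g) (fmap f) }.

Record is_adjunction (C D : category) (F : C -> D) (U : D -> C)
    (FF : functor_on F) (UF : functor_on U)
    (eta : forall c, hom c (U (F c))) (eps : forall d, hom (F (U d)) d) : Prop :=
  IsAdjunction {
    unit_natural : forall c c' (f : hom c c'),
      compc (fmap UF (fmap FF f)) (eta c) = compc (eta c') f;
    counit_natural : forall d d' (g : hom d d'),
      compc g (eps d) = compc (eps d') (fmap FF (fmap UF g));
    triangle_left : forall c, compc (eps (F c)) (fmap FF (eta c)) = idc (F c);
    triangle_right : forall d, compc (fmap UF (eps d)) (eta (U d)) = idc (U d) }.

(* Left G-sets; [{action G &-> T}] of MathComp is a right action. *)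
Record gset (G : finGroupType) := GSet {
  gcarrier :> finType;
  gact : G -> gcarrier -> gcarrier;
  gact1 : forall x, gact 1%g x = x;
  gactM : forall g h x, gact (g * h)%g x = gact g (gact h x) }.

Arguments gact {G g} _ _ : rename.

Record gmap (G : finGroupType) (X Y : gset G) := GMap {
  gfun :> X -> Y;
  gfunJ : forall g x, gfun (gact g x) = gact g (gfun x) }.

Section FinG.
Variable G : finGroupType.
Implicit Types X Y Z A B P T V W : gset G.

Lemma gmapP X Y (f f' : gmap X Y) : f =1 f' -> f = f'.
Proof.
case: f f' => [f fJ] [f' f'J] /= /funext e; rewrite /= in e; subst f'.
by congr GMap; apply: Prop_irrelevance.
Qed.

Definition gid X : gmap X X := GMap (gfun := id) (fun _ _ => erefl).

Lemma gcomp_subproof X Y Z (f : gmap Y Z) (h : gmap X Y) g x :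
  f (h (gact g x)) = gact g (f (h x)).
Proof. by rewrite !gfunJ. Qed.

Definition gcomp X Y Z (f : gmap Y Z) (h : gmap X Y) : gmap X Z :=
  GMap (gcomp_subproof f h).

Definition is_iso X Y (f : gmap X Y) : Prop :=
  exists f' : gmap Y X, gcomp f' f = gid X /\ gcomp f f' = gid Y.

Definition is_pullback P X Y Z
    (p : gmap P X) (q : gmap P Y) (j : gmap X Z) (i : gmap Y Z) : Prop :=
  gcomp j p = gcomp i q /\
  forall T (a : gmap T X) (b : gmap T Y), gcomp j a = gcomp i b ->
    exists! c : gmap T P, gcomp p c = a /\ gcomp q c = b.

Definition gempty : gset G :=
  GSet (gact := fun _ (x : void) => x) (fun _ => erefl) (fun _ _ _ => erefl).

Definition gfrom_empty X : gmap gempty X :=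
  GMap (gfun := fun x : gempty => match x with end) (fun _ x => match x with end).

Definition gsum_act X Y (g : G) (w : X + Y) : X + Y :=
  match w with inl x => inl (gact g x) | inr y => inr (gact g y) end.

Lemma gsum_act1 X Y (w : X + Y) : gsum_act 1%g w = w.
Proof. by case: w => w /=; rewrite gact1. Qed.

Lemma gsum_actM X Y g h (w : X + Y) :
  gsum_act (g * h)%g w = gsum_act g (gsum_act h w).
Proof. by case: w => w /=; rewrite gactM. Qed.

Definition gsum X Y : gset G := GSet (@gsum_act1 X Y) (@gsum_actM X Y).

Definition ginl X Y : gmap X (gsum X Y) :=
  GMap (Y := gsum X Y) (gfun := inl) (fun _ _ => erefl).
Definition ginr X Y : gmap Y (gsum X Y) :=
  GMap (Y := gsum X Y) (gfun := inr) (fun _ _ => erefl).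

Definition gcase_fun X Y Z (f : gmap X Z) (f' : gmap Y Z) (w : gsum X Y) : Z :=
  match w with inl x => f x | inr y => f' y end.

Lemma gcase_subproof X Y Z (f : gmap X Z) (f' : gmap Y Z) g w :
  gcase_fun f f' (gact g w) = gact g (gcase_fun f f' w).
Proof. by case: w => w /=; rewrite gfunJ. Qed.

Definition gcase X Y Z (f : gmap X Z) (f' : gmap Y Z) : gmap (gsum X Y) Z :=
  GMap (gcase_subproof f f').

Definition gfold X : gmap (gsum X X) X := gcase (gid X) (gid X).

Section Fibre.
Variables (X Y Z : gset G) (j : gmap X Z) (i : gmap Y Z).

Definition fibre := {w : X * Y | j w.1 == i w.2}.

Lemma fibre_act_subproof (g : G) (w : fibre) :
  j (gact g (val w).1) == i (gact g (val w).2).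
Proof. by rewrite !gfunJ (eqP (valP w)). Qed.

Definition fibre_act (g : G) (w : fibre) : fibre :=
  exist _ (gact g (val w).1, gact g (val w).2) (fibre_act_subproof g w).

Lemma fibre_act1 w : fibre_act 1%g w = w.
Proof. by case: w => -[x y] xyP; apply: val_inj; rewrite /= !gact1. Qed.

Lemma fibre_actM g h w : fibre_act (g * h)%g w = fibre_act g (fibre_act h w).
Proof. by apply: val_inj; rewrite /= !gactM. Qed.

Definition gfibre : gset G := GSet fibre_act1 fibre_actM.

Definition gfst : gmap gfibre X :=
  GMap (X := gfibre) (gfun := fun w : fibre => (val w).1) (fun _ _ => erefl).
Definition gsnd : gmap gfibre Y :=
  GMap (X := gfibre) (gfun := fun w : fibre => (val w).2) (fun _ _ => erefl).
End Fibre.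

Section Exponential.
Variables (X Y Z : gset G) (i : gmap X Y) (j : gmap Y Z).

(* A section s : j^-1(z) -> X of i is encoded by its extension by [None]
   to the whole of Y. *)
Definition is_section (z : Z) (s : {ffun Y -> option X}) : bool :=
  [forall y, if s y is Some x then (j y == z) && (i x == y) else j y != z].

Definition dprod := {zs : Z * {ffun Y -> option X} | is_section zs.1 zs.2}.

Definition dprod_act_pair (g : G) (d : dprod) : Z * {ffun Y -> option X} :=
  (gact g (val d).1, [ffun y => omap (gact g) ((val d).2 (gact g^-1%g y))]).

Lemma dprod_act_subproof (g : G) (d : dprod) :
  is_section (dprod_act_pair g d).1 (dprod_act_pair g d).2.
Proof.
case: d => -[z s] /= /forallP sP; apply/forallP => y; rewrite ffunE.
have gK W (w : W) : gact g (gact g^-1%g w) = w by rewrite -gactM mulgV gact1.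
have gVK W (w : W) : gact g^-1%g (gact g w) = w by rewrite -gactM mulVg gact1.
have := sP (gact g^-1%g y); case: (s _) => [x|] /=; rewrite gfunJ.
  by case/andP=> /eqP<- /eqP ix; rewrite gfunJ ix !gK !eqxx.
by apply: contraNN => /eqP->; rewrite gVK.
Qed.

Definition dprod_act (g : G) (d : dprod) : dprod :=
  exist _ (dprod_act_pair g d) (dprod_act_subproof g d).

Lemma dprod_act1 d : dprod_act 1%g d = d.
Proof.
case: d => -[z s] sP; apply: val_inj; rewrite /= /dprod_act_pair /= gact1.
congr pair; apply/ffunP => y; rewrite ffunE invg1 gact1.
by case: (s y) => //= x; rewrite gact1.
Qed.

Lemma dprod_actM g h d : dprod_act (g * h)%g d = dprod_act g (dprod_act h d).
Proof.
case: d => -[z s] sP; apply: val_inj; rewrite /= /dprod_act_pair /= gactM.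
congr pair; apply/ffunP => y; rewrite !ffunE invMg gactM.
by case: (s _) => //= x; rewrite gactM.
Qed.

(* The dependent product of X along j, i.e. the set of pairs (z, s). *)
Definition gdprod : gset G := GSet dprod_act1 dprod_actM.

Definition dprod_proj : gmap gdprod Z :=
  GMap (X := gdprod) (gfun := fun d : dprod => (val d).1) (fun _ _ => erefl).

Definition gexp : gset G := gfibre j dprod_proj.

Lemma section_def (w : gexp) : exists x, (val (val w).2).2 (val w).1 == Some x.
Proof.
case: w => -[y [[z s] sP]] /= /eqP jy; move/forallP/(_ y): (sP) => /=.
by case: (s y) => [x _|]; [exists x | rewrite jy eqxx].
Qed.

(* e (y, (z, s)) = s y *)
Definition dprod_ev_fun (w : gexp) : X := xchoose (section_def w).

Lemma dprod_evE (w : gexp) : (val (val w).2).2 (val w).1 = Some (dprod_ev_fun w).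
Proof. exact/eqP/(xchooseP (section_def w)). Qed.

Lemma dprod_ev_subproof g w : dprod_ev_fun (gact g w) = gact g (dprod_ev_fun w).
Proof.
apply: Some_inj; rewrite -dprod_evE /= ffunE -gactM mulVg gact1.
by rewrite dprod_evE.
Qed.

Definition dprod_ev : gmap gexp X := GMap dprod_ev_subproof.

Definition dprod_pi2 : gmap gexp gdprod := gsnd j dprod_proj.

Definition is_distributor A B
    (f : gmap A X) (g : gmap A B) (h : gmap B Z) : Prop :=
  exists (a : gmap A gexp) (b : gmap B gdprod),
    [/\ is_iso a, is_iso b, f = gcomp dprod_ev a,
        gcomp b g = gcomp dprod_pi2 a & h = gcomp dprod_proj b].
End Exponential.

Lemma gmap_of_rel X Y (R : X -> Y -> Prop) :
    (forall g x y, R x y -> R (gact g x) (gact g y)) ->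
    (forall x, exists! y, R x y) ->
  exists f : gmap X Y, forall x, R x (f x).
Proof.
move=> RJ Ru; pose f x := sval (cid (Ru x)).
have fP x : unique (R x) (f x) by rewrite /f; case: cid.
have fJ g x : f (gact g x) = gact g (f x).
  by apply: (fP _).2; apply: RJ; exact: (fP x).1.
by exists (GMap fJ) => x; exact: (fP x).1.
Qed.

Lemma is_isoP X Y (f : gmap X Y) : is_iso f <-> forall y, exists! x, f x = y.
Proof.
split=> [[f' [f'K fK]] y|fu].
  exists (f' y); split=> [|x <-]; first exact: (congr1 (fun k : gmap _ _ => k y) fK).
  exact: (congr1 (fun k : gmap _ _ => k x) f'K).
have [g y x <-|y|f' f'P] := @gmap_of_rel Y X (fun y x => f x = y).
- by rewrite gfunJ.
- by have [x] := fu y; exists x.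
exists f'; split; apply: gmapP => x /=; last exact: f'P.
by have [x' [_ x'u]] := fu (f x); rewrite -(x'u _ (f'P _)) -(x'u _ erefl).
Qed.

Lemma is_pullbackP P X Y Z
    (p : gmap P X) (q : gmap P Y) (j : gmap X Z) (i : gmap Y Z) :
  is_pullback p q j i <->
  (forall a, j (p a) = i (q a)) /\
  (forall x y, j x = i y -> exists! a, p a = x /\ q a = y).
Proof.
split=> [[jp pb]|[jp pb]].
  split=> [a|x y jx]; first exact: (congr1 (fun k : gmap _ _ => k a) jp).
  have [|c [[pc qc] _]] := pb _ (gfst j i) (gsnd j i).
    by apply: gmapP => -[[x' y'] /= /eqP].
  have E a : p a = x /\ q a = y -> unique (fun a => p a = x /\ q a = y) a.
    move=> [pa qa]; split=> // a' [pa' qa'].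
    pose F := GSet (gact := fun g h : G => (g * h)%g) (@mul1g G) (fun g h k => esym (mulgA g h k)).
    have FJ (b : P) : forall g h, gact (g * h)%g b = gact g (gact h b) by move=> *; exact: gactM.
    pose m (b : P) : gmap F P := GMap (X := F) (gfun := fun h => gact h b) (FJ b).
    have [|c' [_ c'u]] := pb _ (gcomp p (m a)) (gcomp q (m a)).
      by apply: gmapP => h; exact: (congr1 (fun k : gmap _ _ => k (gact h a)) jp).
    have e1 := c'u (m a) (conj erefl erefl).
    have e2 : c' = m a'.
      by apply: c'u; split; apply: gmapP => h /=; rewrite !gfunJ ?pa ?pa' ?qa ?qa'.
    have := congr1 (fun k : gmap F P => k 1%g) (etrans (esym e1) e2).
    by rewrite /= !gact1.
  have jxb : j (x, y).1 == i (x, y).2 by apply/eqP.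
  pose w : gfibre j i := exist _ (x, y) jxb.
  exists (c w); apply: E; split.
    exact: (congr1 (fun k : gmap _ _ => k w) pc).
  exact: (congr1 (fun k : gmap _ _ => k w) qc).
split=> [|T a b jab]; first exact: gmapP.
have [g t w [pw qw]|t|c cP] :=
    @gmap_of_rel T P (fun t w => p w = a t /\ q w = b t).
- by rewrite !gfunJ pw qw.
- by apply: pb; exact: (congr1 (fun k : gmap _ _ => k t) jab).
exists c; split; first by split; apply: gmapP => t /=; case: (cP t).
move=> c' [pc' qc']; apply: gmapP => t.
have [w [_ wu]] := pb _ _ (congr1 (fun k : gmap _ _ => k t) jab).
rewrite -(wu _ (cP t)); apply: wu; split.
  exact: (congr1 (fun k : gmap _ _ => k t) pc').
exact: (congr1 (fun k : gmap _ _ => k t) qc').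
Qed.

Lemma dprod_ev_sec X Y Z (i : gmap X Y) (j : gmap Y Z) (w : gexp i j) :
  i (dprod_ev i j w) = (val w).1.
Proof.
have := dprod_evE w; case: w => -[y [[z s] sP]] yz /= sy.
by move/forallP/(_ y): (sP) => /=; rewrite sy => /andP[_ /eqP].
Qed.

Lemma dprodP X Y Z (i : gmap X Y) (j : gmap Y Z) (d d' : gdprod i j) :
  (val d).1 = (val d').1 ->
  (forall y, j y = (val d).1 -> (val d).2 y = (val d').2 y) -> d = d'.
Proof.
case: d d' => -[z s] sP [[z' s'] s'P] /= ez; subst z' => ess; apply: val_inj.
congr pair; apply/ffunP => y; have [/eqP|jy] := boolP (j y == z); first exact: ess.
move/forallP/(_ y): (sP); move/forallP/(_ y): (s'P) => /=.
by case: (s y) (s' y) => [?|] [?|] //; rewrite (negPf jy).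
Qed.

Lemma is_distributorP X Y Z A B (i : gmap X Y) (j : gmap Y Z)
    (f : gmap A X) (g : gmap A B) (h : gmap B Z) :
  is_distributor i j f g h <->
  [/\ forall a, j (i (f a)) = h (g a),
      forall b y, j y = h b -> exists! a, i (f a) = y /\ g a = b &
      forall z (s : {ffun Y -> option X}), is_section i j z s ->
        exists! b, h b = z /\ forall a, g a = b -> s (i (f a)) = Some (f a)].
Proof.
split=> [[al [be [/is_isoP ali /is_isoP bei fE gE hE]]]|[D1 D2 D3]].
  have fE' x : f x = dprod_ev i j (al x) by rewrite fE.
  have gE' x : be (g x) = (val (al x)).2 by exact: (congr1 (fun k : gmap _ _ => k x) gE).
  have hE' b : h b = (val (be b)).1 by rewrite hE.
  have be_inj b b' : be b = be b' -> b = b'.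
    by move=> e; have [c [_ cu]] := bei (be b'); rewrite -(cu b) // -(cu b').
  have al1 x : (val (al x)).1 = i (f x) by rewrite fE' dprod_ev_sec.
  have sE x : (val (be (g x))).2 (i (f x)) = Some (f x).
    by rewrite fE' dprod_ev_sec gE' dprod_evE.
  have D2 b y : j y = h b -> exists! a, i (f a) = y /\ g a = b.
    move=> jy; have wP : j (y, be b).1 == dprod_proj i j (y, be b).2 by rewrite /= -hE' jy.
    have [x [xw xu]] := ali (exist _ (y, be b) wP).
    exists x; split=> [|x' [x'y x'b]].
      by split; [rewrite -al1 xw | apply: be_inj; rewrite gE' xw].
    apply: xu; apply: val_inj => /=; rewrite [LHS]surjective_pairing.
    by rewrite al1 -gE' x'y x'b.
  split=> // [x|z s sP].
    by rewrite hE' gE' -al1; have /eqP := valP (al x).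
  have [b [bd bu]] := bei (exist _ (z, s) sP); exists b; split.
    split=> [|x gx]; first by rewrite hE' bd.
    by rewrite -sE gx bd.
  move=> b' [hb' b'P]; apply: bu; apply: dprodP => [|y]; rewrite -hE' // => jy.
  by have [x [[<- gx] _]] := D2 _ _ jy; rewrite -{1}gx sE b'P.
pose R b (d : gdprod i j) :=
  (val d).1 = h b /\ forall x, g x = b -> (val d).2 (i (f x)) = Some (f x).
have gVK W (k : G) (w : W) : gact k^-1%g (gact k w) = w by rewrite -gactM mulVg gact1.
have gKV W (k : G) (w : W) : gact k (gact k^-1%g w) = w by rewrite -gactM mulgV gact1.
have RJ k b d : R b d -> R (gact k b) (gact k d).
  move=> [d1 d2]; split=> [|x gx]; first by rewrite /= d1 gfunJ.
  rewrite /= ffunE -!gfunJ d2 /= ?gfunJ ?gKV //.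
  by rewrite gx gVK.
have Ru b : exists! d, R b d.
  pose s := [ffun y => if [pick x | (i (f x) == y) && (g x == b)] is Some x
                       then Some (f x) else None].
  have sE x : g x = b -> s (i (f x)) = Some (f x).
    move=> gx; rewrite ffunE; case: pickP => [x' /andP[/eqP ix' /eqP gx']|/(_ x)].
      have jx : j (i (f x)) = h b by rewrite D1 gx.
      by have [c [_ cu]] := D2 _ _ jx; rewrite -(cu x) // -(cu x').
    by rewrite eqxx gx eqxx.
  have sP : is_section i j (h b) s.
    apply/forallP => y; rewrite ffunE; case: pickP => [x /andP[/eqP<- /eqP<-]|no].
      by rewrite D1 !eqxx.
    apply/eqP => /D2 [x [[ix gx] _]].
    by have := no x; rewrite ix gx !eqxx.
  exists (exist _ (h b, s) sP); split=> // d [d1 d2].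
  apply: dprodP => //= y /D2 [x [[<- gx] _]].
  by rewrite d2 // sE.
have [be beP] := gmap_of_rel RJ Ru.
pose S x (w : gexp i j) := (val w).1 = i (f x) /\ (val w).2 = be (g x).
have SJ k x w : S x w -> S (gact k x) (gact k w).
  by move=> [w1 w2]; split; rewrite /= ?w1 ?w2 !gfunJ.
have Su x : exists! w, S x w.
  have wP : j (i (f x), be (g x)).1 == dprod_proj i j (i (f x), be (g x)).2.
    by rewrite /= D1 (beP _).1.
  exists (exist _ (_, _) wP); split=> // w [w1 w2]; apply: val_inj => /=.
  by rewrite -w1 -w2 -surjective_pairing.
have [al alP] := gmap_of_rel SJ Su.
have bei : is_iso be.
  apply/is_isoP => d; have [b [[hb bP] bu]] := D3 _ _ (valP d).
  have Ruq b' d' : R b' d' -> be b' = d'.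
    by have [c [_ cu]] := Ru b' => Rd; rewrite -(cu _ Rd); apply/esym/cu.
  exists b; split; first by apply: Ruq.
  by move=> b' e; apply: bu; rewrite -e; case: (beP b').
exists al, be; split=> //.
- apply/is_isoP => w; have [b [bw bu]] := (is_isoP be).1 bei (val w).2.
  have jw : j (val w).1 = h b by rewrite -(beP b).1 bw; apply/eqP: (valP w).
  have [x [[ix gx] xu]] := D2 _ _ jw; exists x; split.
    apply: val_inj; rewrite /= [LHS]surjective_pairing [RHS]surjective_pairing.
    by rewrite (alP x).1 (alP x).2 ix gx bw.
  move=> x' x'w; apply: xu; rewrite -(alP x').1 x'w; split=> //.
  by apply/esym/bu; rewrite -(alP x').2 x'w.
- apply: gmapP => x /=; apply: Some_inj; rewrite -dprod_evE.
  by rewrite (alP x).1 (alP x).2 (beP _).2.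
- by apply: gmapP => x /=; rewrite (alP x).2.
- by apply: gmapP => b /=; rewrite (beP b).1.
Qed.

End FinG.

Section Induction.
Variables (G : finGroupType) (H : {group G}).
Implicit Types (X Y : gset (subg_of H)) (V : gset G).

Definition gres V : gset (subg_of H) :=
  @GSet (subg_of H) V (fun h v => gact (sgval h) v) (@gact1 G V)
    (fun h k v => @gactM G V (sgval h) (sgval k) v).

Definition gres_map V V' (f : gmap V V') : gmap (gres V) (gres V') :=
  @GMap (subg_of H) (gres V) (gres V') f (fun h v => gfunJ f (sgval h) v).

(* (g h, x) ~ (g, h x) *)
Definition ind_rel X (p q : G * X) : bool :=
  [exists h : subg_of H, (p.1 == q.1 * sgval h)%g && (q.2 == gact h p.2)].

Lemma ind_rel_refl X : reflexive (@ind_rel X).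
Proof. by move=> p; apply/existsP; exists 1%g; rewrite mulg1 gact1 !eqxx. Qed.

Lemma ind_rel_sym X : symmetric (@ind_rel X).
Proof.
suff S p q : ind_rel p q -> @ind_rel X q p by move=> p q; apply/idP/idP; exact: S.
case/existsP=> h /andP[/eqP p1 /eqP q2]; apply/existsP; exists (h^-1)%g.
rewrite q2 -gactM mulVg gact1 eqxx p1 -mulgA.
have -> : (sgval h * sgval h^-1)%g = sgval (h * h^-1)%g by [].
by rewrite mulgV mulg1 eqxx.
Qed.

Lemma ind_rel_trans X : transitive (@ind_rel X).
Proof.
move=> q p r /existsP[h /andP[/eqP p1 /eqP q2]] /existsP[k /andP[/eqP q1 /eqP r2]].
by apply/existsP; exists (k * h)%g; rewrite p1 q1 r2 q2 gactM eqxx -mulgA eqxx.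
Qed.

Canonical ind_equiv X :=
  EquivRel (@ind_rel X) (@ind_rel_refl X) (@ind_rel_sym X) (@ind_rel_trans X).

Definition ind_car X : finType := quot_type {eq_quot (@ind_rel X)}.

(* The class [g, x] in G x_H X. *)
Definition cls X (g : G) (x : X) : ind_car X := \pi_{eq_quot (@ind_rel X)} (g, x).

Lemma clsP X g g' (x x' : X) :
  cls g x = cls g' x' <-> exists h : subg_of H, g = (g' * sgval h)%g /\ x' = gact h x.
Proof.
split=> [/eqmodP/existsP[h /andP[/eqP ? /eqP ?]]|[h [gE xE]]]; first by exists h.
by apply/eqmodP/existsP; exists h; rewrite /= gE xE !eqxx.
Qed.

Definition rep X (w : ind_car X) : G * X := generic_quotient.repr (w : {eq_quot (@ind_rel X)}).

Lemma repK X (w : ind_car X) : cls (rep w).1 (rep w).2 = w.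
Proof. by rewrite /cls -surjective_pairing; exact: reprK. Qed.

Lemma rep_cls X g (x : X) :
  exists h : subg_of H, g = ((rep (cls g x)).1 * sgval h)%g /\ (rep (cls g x)).2 = gact h x.
Proof. by apply/clsP; rewrite repK. Qed.

Definition ind_act X (g : G) (w : ind_car X) : ind_car X :=
  cls (g * (rep w).1)%g (rep w).2.

Lemma ind_act_cls X g g' (x : X) : ind_act g (cls g' x) = cls (g * g')%g x.
Proof.
apply/esym/clsP; have [h [e e']] := rep_cls g' x.
by exists h; rewrite -mulgA -e.
Qed.

Lemma ind_act1 X (w : ind_car X) : ind_act 1%g w = w.
Proof. by rewrite -(repK w) ind_act_cls mul1g. Qed.

Lemma ind_actM X g g' (w : ind_car X) :
  ind_act (g * g')%g w = ind_act g (ind_act g' w).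
Proof. by rewrite -(repK w) !ind_act_cls mulgA. Qed.

Definition gind X : gset G := GSet (@ind_act1 X) (@ind_actM X).

Definition gind_fun X Y (f : gmap X Y) (w : gind X) : gind Y :=
  cls (rep w).1 (f (rep w).2).

Lemma gind_fun_cls X Y (f : gmap X Y) g x : gind_fun f (cls g x) = cls g (f x).
Proof.
apply/esym/clsP; have [h [e e']] := rep_cls g x.
by exists h; rewrite e' gfunJ.
Qed.

Lemma gind_fun_subproof X Y (f : gmap X Y) g w :
  gind_fun f (gact g w) = gact g (gind_fun f w).
Proof. by rewrite -(repK w) /= ind_act_cls !gind_fun_cls ind_act_cls. Qed.

Definition gind_map X Y (f : gmap X Y) : gmap (gind X) (gind Y) :=
  GMap (gind_fun_subproof f).

(* x |-> [1, x] *)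
Lemma gunit_subproof X (h : subg_of H) (x : X) :
  cls 1%g (gact h x) = gact (sgval h) (cls 1%g x : gind X).
Proof. by rewrite /= ind_act_cls mulg1; apply/esym/clsP; exists h; rewrite mul1g. Qed.

Definition gunit X : gmap X (gres (gind X)) :=
  GMap (Y := gres (gind X)) (@gunit_subproof X).

(* [g, v] |-> g v *)
Definition gcounit_fun V (w : gind (gres V)) : V :=
  gact (rep w).1 ((rep w).2 : V).

Lemma gcounit_fun_cls V g (v : gres V) : gcounit_fun (cls g v) = gact g (v : V).
Proof.
have [h [e e']] := rep_cls g v.
by rewrite {2}e gactM /gcounit_fun e'.
Qed.

Lemma gcounit_subproof V g w :
  @gcounit_fun V (gact g w) = gact g (gcounit_fun w).
Proof. by rewrite -(repK w) /= ind_act_cls !gcounit_fun_cls gactM. Qed.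

Definition gcounit V : gmap (gind (gres V)) V := GMap (@gcounit_subproof V).

Lemma gindP X (w : gind X) : exists g x, w = cls g x.
Proof. by exists (rep w).1, (rep w).2; rewrite repK. Qed.

Lemma cls_inj X g (x x' : X) : cls g x = cls g x' -> x = x'.
Proof.
case/clsP=> h [/esym/(canRL (mulKg g)) + ->]; rewrite mulVg => h1.
by have -> : h = 1%g; [apply: val_inj | rewrite gact1].
Qed.

Lemma gind_fibre X Y (f : gmap X Y) w g y :
  gind_map f w = cls g y -> exists2 x, w = cls g x & f x = y.
Proof.
have [g' [x ->]] := gindP w; rewrite /= gind_fun_cls.
case/clsP=> h [-> ->]; exists (gact h x); last by rewrite gfunJ.
by apply/clsP; exists h.
Qed.

Lemma gind_map1 X : gind_map (gid X) = gid (gind X).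
Proof. by apply: gmapP => w; rewrite -(repK w) /= gind_fun_cls. Qed.

Lemma gind_mapM X Y Z (f : gmap Y Z) (k : gmap X Y) :
  gind_map (gcomp f k) = gcomp (gind_map f) (gind_map k).
Proof. by apply: gmapP => w; rewrite -(repK w) /= !gind_fun_cls. Qed.

Lemma gind_pullback P X Y Z (p : gmap P X) (q : gmap P Y) (j : gmap X Z) (i : gmap Y Z) :
  is_pullback p q j i ->
  is_pullback (gind_map p) (gind_map q) (gind_map j) (gind_map i).
Proof.
move=> /is_pullbackP[jp pb]; apply/is_pullbackP; split=> [w|x y].
  by rewrite -(repK w) /= !gind_fun_cls jp.
have [g [y0 ->]] := gindP y; rewrite [RHS]gind_fun_cls => /gind_fibre[x0 -> e].
have [c [[pc qc] cu]] := pb _ _ e; exists (cls g c); split.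
  by rewrite /= !gind_fun_cls pc qc.
move=> w [pw qw]; have [c' wE pc'] := gind_fibre pw; rewrite wE.
by congr cls; apply: cu; split=> //; apply: (@cls_inj _ g); rewrite -gind_fun_cls -wE.
Qed.

Lemma gind_distributor X Y Z A B (i : gmap X Y) (j : gmap Y Z)
    (f : gmap A X) (g : gmap A B) (h : gmap B Z) :
  is_distributor i j f g h ->
  is_distributor (gind_map i) (gind_map j) (gind_map f) (gind_map g) (gind_map h).
Proof.
move=> /is_distributorP[D1 D2 D3]; apply/is_distributorP; split.
- by move=> w; rewrite -(repK w) /= !gind_fun_cls D1.
- move=> b y; have [k [b0 ->]] := gindP b.
  rewrite [RHS]gind_fun_cls => /gind_fibre[y0 -> e].
  have [a [[ia ga] au]] := D2 _ _ e; exists (cls k a); split.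
    by rewrite /= !gind_fun_cls ia ga.
  move=> w [iw gw]; have [a' wE ga'] := gind_fibre gw; rewrite wE.
  congr cls; apply: au; split=> //; apply: (@cls_inj _ k).
  by rewrite -!gind_fun_cls -wE.
move=> z s /forallP sP; have [k [z0 zE]] := gindP z; rewrite {}zE in sP *.
pose s0 := [ffun y => if j y == z0 then [pick x | s (cls k y) == Some (cls k x)] else None].
have s0E y x : s0 y = Some x -> s (cls k y) = Some (cls k x).
  by rewrite ffunE; case: ifP => // _; case: pickP => // x' /eqP-> [->].
have s0P : is_section i j z0 s0.
  apply/forallP=> y; rewrite ffunE; case: ifPn => // /eqP jy.
  have := sP (cls k y); rewrite [gind_map j _]gind_fun_cls jy eqxx.
  case sy : (s _) => [w|] //= /eqP /gind_fibre[x wE ix].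
  case: pickP => [x' /eqP[]|/(_ x)]; rewrite wE ?eqxx //.
  by move/cls_inj=> <-; rewrite ix !eqxx.
have sE b a : h b = z0 -> (forall a, g a = b -> s0 (i (f a)) = Some (f a)) ->
    gind_map g a = cls k b -> s (gind_map i (gind_map f a)) = Some (gind_map f a).
  move=> hb bP /gind_fibre[a0 -> ga].
  by rewrite /= !gind_fun_cls; apply: s0E; exact: bP.
have [b [[hb bP] bu]] := D3 _ _ s0P; exists (cls k b); split.
  by split=> [|a]; [rewrite /= gind_fun_cls hb | apply: sE].
move=> w [/gind_fibre[b' wE hb'] wP]; rewrite wE in wP *.
congr cls; apply: bu; split=> // a ga; rewrite ffunE D1 ga hb' eqxx.
have := wP (cls k a); rewrite /= !gind_fun_cls ga => -> //.
by case: pickP => [x /eqP[/cls_inj->]|/(_ (f a))] //; rewrite eqxx.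
Qed.

Lemma gind_sum X Y :
  is_iso (gcase (gind_map (ginl X Y)) (gind_map (ginr X Y))).
Proof.
apply/is_isoP => w; have [g [[x|y] ->]] := gindP w.
  exists (inl (cls g x)); split=> [|[w' /gind_fibre[x' -> [->]]|w' /gind_fibre[]]] //.
  by rewrite /= gind_fun_cls.
exists (inr (cls g y)); split=> [|[w' /gind_fibre[]|w' /gind_fibre[y' -> [->]]]] //.
by rewrite /= gind_fun_cls.
Qed.

Lemma gind_empty : is_iso (gfrom_empty (gind (gempty (subg_of H)))).
Proof. by apply/is_isoP => w; have [g []] := gindP w. Qed.
End Induction.

Arguments gres {G} H V.
Arguments gres_map {G} H {V V'} f.
Arguments gcounit {G} H V.

(* Semi-Tambara structures on a given family of values: restrictions [rmap],
   transfers [tmap] and norms [nmap].  Nonemptiness and [rmap_coprod] force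
   the value at the empty G-set to be a point. *)
Record semi_on (G : finGroupType) (M : gset G -> Type) := SemiOn {
  rmap : forall X Y, gmap X Y -> M Y -> M X;
  tmap : forall X Y, gmap X Y -> M X -> M Y;
  nmap : forall X Y, gmap X Y -> M X -> M Y;
  nonempty : forall X, inhabited (M X);
  rmap1 : forall X (u : M X), rmap (gid X) u = u;
  rmapM : forall X Y Z (f : gmap Y Z) (k : gmap X Y) (u : M Z),
    rmap (gcomp f k) u = rmap k (rmap f u);
  tmap1 : forall X (u : M X), tmap (gid X) u = u;
  tmapM : forall X Y Z (f : gmap Y Z) (k : gmap X Y) (u : M X),
    tmap (gcomp f k) u = tmap f (tmap k u);
  nmap1 : forall X (u : M X), nmap (gid X) u = u;
  nmapM : forall X Y Z (f : gmap Y Z) (k : gmap X Y) (u : M X),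
    nmap (gcomp f k) u = nmap f (nmap k u);
  rmap_coprod : forall X Y (a : M X) (b : M Y),
    exists! w : M (gsum X Y), rmap (ginl X Y) w = a /\ rmap (ginr X Y) w = b;
  rmap_tmap : forall P X Y Z
      (p : gmap P X) (q : gmap P Y) (j : gmap X Z) (i : gmap Y Z),
    is_pullback p q j i -> forall u : M Y, rmap j (tmap i u) = tmap p (rmap q u);
  rmap_nmap : forall P X Y Z
      (p : gmap P X) (q : gmap P Y) (j : gmap X Z) (i : gmap Y Z),
    is_pullback p q j i -> forall u : M Y, rmap j (nmap i u) = nmap p (rmap q u);
  nmap_tmap : forall X Y Z A B (i : gmap X Y) (j : gmap Y Z)
      (f : gmap A X) (g : gmap A B) (h : gmap B Z),
    is_distributor i j f g h ->
    forall u : M X, nmap j (tmap i u) = tmap h (nmap g (rmap f u)) }.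

Record semi_tambara (G : finGroupType) := SemiTambara {
  val_of :> gset G -> Type;
  str_of :> semi_on val_of }.

Arguments SemiTambara {G val_of} str_of.

Section Tambara.
Variable G : finGroupType.

Section Monoid.
Variable M : semi_tambara G.

Definition pairing (X Y : gset G) (a : M X) (b : M Y) : M (gsum X Y) :=
  sval (cid (rmap_coprod M a b)).

Definition tadd (X : gset G) (a b : M X) : M X := tmap M (gfold X) (pairing a b).

Definition tzero (X : gset G) : M X :=
  tmap M (gfrom_empty X) (inhabited_witness (nonempty M (gempty G))).

Definition is_tambara : Prop :=
  forall (X : gset G) (a : M X), exists b, tadd a b = tzero X.

Lemma pairingE (X Y : gset G) (w : M (gsum X Y)) :
  pairing (rmap M (ginl X Y) w) (rmap M (ginr X Y) w) = w.
Proof. by rewrite /pairing; case: cid => /= w' [_]; apply. Qed.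

Lemma pairing_l (X Y : gset G) (a : M X) (b : M Y) : rmap M (ginl X Y) (pairing a b) = a.
Proof. by rewrite /pairing; case: cid => /= w' [[]]. Qed.

Lemma pairing_r (X Y : gset G) (a : M X) (b : M Y) : rmap M (ginr X Y) (pairing a b) = b.
Proof. by rewrite /pairing; case: cid => /= w' [[]]. Qed.

Lemma empty_irr (u v : M (gempty G)) : u = v.
Proof.
have i : ginl (gempty G) (gempty G) = ginr _ _ by apply: gmapP; case.
by rewrite -(pairing_l u v) i pairing_r.
Qed.

Lemma rmap_iso (X Y : gset G) (f : gmap X Y) : is_iso f -> bijective (rmap M f).
Proof.
by case=> f' [f'f ff']; exists (rmap M f') => u; rewrite -rmapM ?ff' ?f'f rmap1.
Qed.

Lemma tmap_rmap_iso (X Y : gset G) (f : gmap X Y) u :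
  is_iso f -> tmap M f (rmap M f u) = u.
Proof.
move=> fi; have [f' [f'f ff']] := fi.
have pb : is_pullback (gid X) (gid X) f f.
  apply/is_pullbackP; split=> // x y e; exists x; split=> [|z []] //.
  have := congr1 f' e.
  have f'K z : f' (f z) = z by exact: (congr1 (fun k : gmap _ _ => k z) f'f).
  by rewrite !f'K.
have tE v : rmap M f (tmap M f v) = v by rewrite (rmap_tmap M pb) rmap1 tmap1.
by have [k fK kK] := rmap_iso fi; rewrite -[RHS]fK -[LHS]fK tE.
Qed.
End Monoid.

Record tambara := Tambara {
  semi_of :> semi_tambara G;
  tambaraP : is_tambara semi_of }.

Record smorph (M N : semi_tambara G) := SMorph {
  smap :> forall X, M X -> N X;
  smapR : forall X Y (f : gmap X Y) u, smap (rmap M f u) = rmap N f (smap u);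
  smapT : forall X Y (f : gmap X Y) u, smap (tmap M f u) = tmap N f (smap u);
  smapN : forall X Y (f : gmap X Y) u, smap (nmap M f u) = nmap N f (smap u) }.

Lemma smorphP (M N : semi_tambara G) (phi psi : smorph M N) :
  (forall X u, phi X u = psi X u) -> phi = psi.
Proof.
case: phi psi => [a ar at_ an] [b br bt bn] /= ab.
have e : a = b by apply: functional_extensionality_dep => X; apply/funext/ab.
by subst b; congr SMorph; apply: Prop_irrelevance.
Qed.

Definition smorph1 (M : semi_tambara G) : smorph M M :=
  @SMorph M M (fun X u => u) (fun _ _ _ _ => erefl) (fun _ _ _ _ => erefl)
    (fun _ _ _ _ => erefl).

Definition smorphM (M N P : semi_tambara G) (psi : smorph N P) (phi : smorph M N) :
  smorph M P.
Proof.
by exists (fun X u => psi X (phi X u)) => X Y f u;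
  rewrite ?smapR ?smapT ?smapN.
Defined.

Definition tambara_cat : category.
Proof.
by refine (@Category tambara (fun M N => smorph M N) (fun M => smorph1 M)
  (fun M N P => @smorphM M N P) _ _ _) => *; exact: smorphP.
Defined.
End Tambara.

Section Restriction.
Variables (G : finGroupType) (H : {group G}).

Definition res_on (R : semi_tambara G) :
  semi_on (fun X : gset (subg_of H) => R (gind X)).
Proof.
refine (@SemiOn (subg_of H) (fun X => R (gind X))
  (fun X Y f => rmap R (gind_map f)) (fun X Y f => tmap R (gind_map f))
  (fun X Y f => nmap R (gind_map f)) (fun X => nonempty R (gind X))
  _ _ _ _ _ _ _ _ _ _).
- by move=> X u; rewrite gind_map1 rmap1.
- by move=> *; rewrite gind_mapM rmapM.
- by move=> X u; rewrite gind_map1 tmap1.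
- by move=> *; rewrite gind_mapM tmapM.
- by move=> X u; rewrite gind_map1 nmap1.
- by move=> *; rewrite gind_mapM nmapM.
- move=> X Y a b; set c := gcase (gind_map (ginl X Y)) (gind_map (ginr X Y)).
  have [k fK kK] := rmap_iso R (gind_sum X Y).
  have cl : gind_map (ginl X Y) = gcomp c (ginl _ _) by apply: gmapP.
  have cr : gind_map (ginr X Y) = gcomp c (ginr _ _) by apply: gmapP.
  exists (k (pairing a b)); rewrite cl cr; split=> [|w [<- <-]].
    by rewrite !rmapM !kK pairing_l pairing_r.
  by rewrite !rmapM pairingE fK.
- by move=> P X Y Z p q j i /(@gind_pullback G H)/(rmap_tmap R).
- by move=> P X Y Z p q j i /(@gind_pullback G H)/(rmap_nmap R).
- by move=> X Y Z A B i j f g h /(@gind_distributor G H)/(nmap_tmap R).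
Defined.

Definition res_semi (R : semi_tambara G) : semi_tambara (subg_of H) :=
  SemiTambara (res_on R).

Lemma add_res (R : semi_tambara G) X (a b : res_semi R X) :
  tadd a b = @tadd G R (gind X) a b.
Proof.
rewrite /tadd; set c := gcase (gind_map (ginl X X)) (gind_map (ginr X X)).
have e : gfold (gind X) = gcomp (gind_map (gfold X)) c.
  by apply: gmapP => -[] w; rewrite -(repK w) /= !gind_fun_cls.
have -> : @pairing G R (gind X) (gind X) a b = rmap R c (@pairing _ (res_semi R) X X a b).
  rewrite -[RHS]pairingE -!rmapM.
  have -> : gcomp c (ginl _ _) = gind_map (ginl X X) by apply: gmapP.
  have -> : gcomp c (ginr _ _) = gind_map (ginr X X) by apply: gmapP.
  congr pairing; first exact/esym/(@pairing_l _ (res_semi R) X X a b).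
  exact/esym/(@pairing_r _ (res_semi R) X X a b).
by rewrite /tadd e tmapM tmap_rmap_iso //; exact: gind_sum.
Qed.

Lemma zero_res (R : semi_tambara G) X : tzero (res_semi R) X = tzero R (gind X).
Proof.
rewrite /tzero; set c := gfrom_empty (gind (gempty (subg_of H))).
set u := inhabited_witness _; set v := inhabited_witness _.
have -> : v = rmap R c u by exact: empty_irr.
have -> : gfrom_empty (gind X) = gcomp (gind_map (gfrom_empty X)) c.
  by apply: gmapP; case.
by rewrite tmapM tmap_rmap_iso //; exact: gind_empty.
Qed.

Lemma res_tambara (R : tambara G) : is_tambara (res_semi R).
Proof.
move=> X a; have [b ab] := @tambaraP G R (gind X) a.
by exists b; rewrite add_res zero_res.
Qed.

Definition res (R : tambara_cat G) : tambara_cat (subg_of H) :=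
  Tambara (@res_tambara R).

Definition res_map (R R' : tambara_cat G) (phi : smorph R R') :
    smorph (res R) (res R') :=
  @SMorph _ (res R) (res R') (fun X => phi (gind X))
    (fun X Y f => smapR phi (gind_map f)) (fun X Y f => smapT phi (gind_map f))
    (fun X Y f => smapN phi (gind_map f)).

Definition res_functor : functor_on res :=
  @FunctorOn (tambara_cat G) (tambara_cat (subg_of H)) res res_map
    (fun _ => smorphP (fun _ _ => erefl)) (fun _ _ _ _ _ => smorphP (fun _ _ => erefl)).
End Restriction.

Arguments res {G} H R.
Arguments res_functor {G} H.

(* Meaningful only for an equivalence relation [E]. *)
Definition qset (T : Type) (E : T -> T -> Prop) : Type :=
  {C : T -> Prop | exists x, C = E x}.

Definition qclass (T : Type) (E : T -> T -> Prop) (x : T) : qset E :=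
  exist _ (E x) (ex_intro _ x erefl).

Section SemiNorm.
Variables (G : finGroupType) (H : {group G}) (R : semi_tambara (subg_of H)).

Record npair (X : gset G) := Pair {
  pairV : gset G;
  pairj : gmap pairV X;
  pairu : R (gres H pairV) }.

(* Under the identification of G x_H Res V with G/H x V given by
   [g, v] |-> (gH, g v), the projection to V is [gcounit H V]. *)
Inductive pair_step (X : gset G) : npair X -> npair X -> Prop :=
| pair_iso (V V' : gset G) (j : gmap V X) (j' : gmap V' X) (f : gmap V' V)
    (u : R (gres H V)) (u' : R (gres H V')) :
    is_iso f -> gcomp j f = j' -> rmap R (gres_map H f) u = u' ->
    pair_step (Pair j u) (Pair j' u')
| pair_transfer (V D : gset G) (W : gset (subg_of H)) (j : gmap V X)
    (f : gmap W (gres H V)) (w : R W) (e : gmap (gres H D) W) (p : gmap D V) :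
    is_distributor (gind_map f) (gcounit H V) (gind_map e) (gcounit H D) p ->
    pair_step (Pair j (tmap R f w)) (Pair (gcomp j p) (rmap R e w)).

Definition pair_equiv (X : gset G) : npair X -> npair X -> Prop :=
  clos_refl_sym_trans (npair X) (@pair_step X).

Definition sN (X : gset G) : Type := qset (@pair_equiv X).

Definition sN_class (X V : gset G) (j : gmap V X) (u : R (gres H V)) : sN X :=
  qclass (@pair_equiv X) (Pair j u).

(* The operations of sN R; since every element of [sN X] is some
   [sN_class j u], they are determined by these formulas. *)
Record sN_structure := SNStructure {
  sN_on : semi_on sN;
  tmap_sN : forall X Y (f : gmap X Y) V (j : gmap V X) u,
    tmap sN_on f (sN_class j u) = sN_class (gcomp f j) u;
  rmap_sN : forall X Y (f : gmap X Y) V (j : gmap V Y) u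
      V' (j' : gmap V' X) (k : gmap V' V),
    is_pullback j' k f j ->
    rmap sN_on f (sN_class j u) = sN_class j' (rmap R (gres_map H k) u);
  nmap_sN : forall X Y (f : gmap X Y) V (j : gmap V X) u
      E D (e : gmap E V) (k : gmap E D) (p : gmap D Y),
    is_distributor j f e k p ->
    nmap sN_on f (sN_class j u) =
      sN_class p (nmap R (gres_map H k) (rmap R (gres_map H e) u)) }.

Definition sN_semi (S : sN_structure) : semi_tambara G := SemiTambara (sN_on S).
End SemiNorm.

Section Completion.
Variables (G : finGroupType) (M : semi_tambara G).

(* Grothendieck's equivalence; (a, b) stands for a - b. *)
Definition gr_equiv (X : gset G) (p q : M X * M X) : Prop :=
  exists k, tadd (tadd p.1 q.2) k = tadd (tadd q.1 p.2) k.

Definition gr (X : gset G) : Type := qset (@gr_equiv X).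

Definition gr_diff (X : gset G) (a b : M X) : gr X := qclass (@gr_equiv X) (a, b).

Definition to_gr (X : gset G) (a : M X) : gr X := gr_diff a (tzero M X).

(* The Tambara functor structure on the levelwise group completion: [rmap] and
   [tmap] are the induced group homomorphisms and [nmap] extends the norms of M.
   Norms in a Tambara functor are determined by their values on a
   generating submonoid, so there is at most one such structure. *)
Record completion_structure := CompletionStructure {
  gr_on : semi_on gr;
  gr_tambara : is_tambara (SemiTambara gr_on);
  rmap_gr : forall X Y (f : gmap X Y) a b,
    rmap gr_on f (gr_diff a b) = gr_diff (rmap M f a) (rmap M f b);
  tmap_gr : forall X Y (f : gmap X Y) a b,
    tmap gr_on f (gr_diff a b) = gr_diff (tmap M f a) (tmap M f b);
  nmap_gr : forall X Y (f : gmap X Y) a,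
    nmap gr_on f (to_gr a) = to_gr (nmap M f a) }.

Definition completion (K : completion_structure) : tambara G :=
  Tambara (@gr_tambara K).
End Completion.

Section Norm.
Variables (G : finGroupType) (H : {group G}).
Variable S : forall R : semi_tambara (subg_of H), sN_structure R.
Variable K : forall M : semi_tambara G, completion_structure M.

Definition tambara_norm (R : tambara_cat (subg_of H)) : tambara_cat G :=
  completion (K (sN_semi (S (semi_of R)))).

Definition tambara_norm_class (R : tambara_cat (subg_of H)) (X V : gset G) (j : gmap V X)
    (u : semi_of R (gres H V)) : semi_of (tambara_norm R) X :=
  @to_gr G (sN_semi (S (semi_of R))) X (sN_class j u).
End Norm.

Arguments tambara_norm_class {G H} S K R {X V} j u.

(* Main.v *)
From mathcomp Require Import all_boot all_fingroup.
From mathcomp Require Import boolp.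
From Stdlib Require Import Relation_Operators.
Require Import Defs.

(* Transfers, restrictions and norms of pairs (V -> X, u) respect the relation
   defining sN R because distributors paste: the dependent product of G-sets is a
   right adjoint, and D_H(W, f, V) -> V is the dependent product of the induced
   map along G x_H Res V -> V, i.e. a pullback of coinduced G-sets.  All the
   compatibilities of distributors are checked on this universal property.

   The norms of a semi-Tambara functor are polynomial maps of commutative
   monoids: expanding n_g(x + a), the sections of the fold map that do not choose
   x everywhere involve x only along smaller fibres.  A polynomial map to an
   abelian group extends uniquely to the group completion, and composites of
   polynomial maps are polynomial, so every identity between norms passes from M
   to its completion.

   For the adjunction, everything is determined by the classes of pairs (V, u),
   on which (V -j-> X, u) = t_j n_eps (id, n_eta u) gives the triangle identities. *)

Set Implicit Arguments.
Unset Strict Implicit.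
Unset Printing Implicit Defensive.

(** * Cartesian squares and distributors *)

Section Cartesian.
Variable G : finGroupType.
Implicit Types P T X Y Z A B E D V : gset G.

Lemma gactK X (g : G) : cancel (gact g) (@gact G X g^-1%g).
Proof. by move=> x; rewrite -gactM mulVg gact1. Qed.

Lemma gactVK X (g : G) : cancel (gact g^-1%g) (@gact G X g).
Proof. by move=> x; rewrite -gactM mulgV gact1. Qed.

Lemma gmap_rel X Y (R : X -> Y -> Prop) :
    (forall g x y, R x y -> R (gact g x) (gact g y)) ->
    (forall x, exists y, R x y) -> (forall x y y', R x y -> R x y' -> y = y') ->
  exists f : gmap X Y, forall x, R x (f x).
Proof.
move=> RJ Re Ru; apply: gmap_of_rel RJ _ => x; have [y Rxy] := Re x.
by exists y; split=> // y'; apply: Ru.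
Qed.

Record cart P X Y Z (p : gmap P X) (q : gmap P Y) (j : gmap X Z) (i : gmap Y Z) : Prop :=
  Cart {
    cart_comm : forall a, j (p a) = i (q a);
    cart_ex : forall x y, j x = i y -> exists a, p a = x /\ q a = y;
    cart_inj : forall a a', p a = p a' -> q a = q a' -> a = a' }.

Lemma cartP P X Y Z (p : gmap P X) (q : gmap P Y) (j : gmap X Z) (i : gmap Y Z) :
  is_pullback p q j i <-> cart p q j i.
Proof.
rewrite is_pullbackP; split=> [[c pb]|[c ex inj]].
  split=> // [x y e|a a' ep eq_]; first by have [a [ae _]] := pb _ _ e; exists a.
  by have [b [_ bu]] := pb _ _ (c a'); exact: etrans (esym (bu a (conj ep eq_))) (bu a' (conj erefl erefl)).
split=> // x y e; have [a [ax ay]] := ex _ _ e; exists a; split=> // a' [ax' ay'].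
by apply: inj; rewrite ?ax ?ay.
Qed.

Lemma cart_lift P X Y Z (p : gmap P X) (q : gmap P Y) (j : gmap X Z) (i : gmap Y Z)
    T (a : gmap T X) (b : gmap T Y) :
  cart p q j i -> (forall t, j (a t) = i (b t)) ->
  exists c : gmap T P, (forall t, p (c t) = a t) /\ (forall t, q (c t) = b t).
Proof.
move=> [_ ex inj] e; have [g t w [pw qw]|t|t w w' [pw qw] [pw' qw']|c cP] :=
    @gmap_rel T P (fun t w => p w = a t /\ q w = b t).
- by rewrite !gfunJ pw qw.
- exact: ex.
- by apply: inj; rewrite ?pw ?pw' ?qw ?qw'.
by exists c; split=> t; case: (cP t).
Qed.

Lemma cart_sym P X Y Z (p : gmap P X) (q : gmap P Y) (j : gmap X Z) (i : gmap Y Z) :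
  cart p q j i -> cart q p i j.
Proof.
move=> [c ex inj]; split=> // [y x e|]; last by move=> a a' ? ?; apply: inj.
by have [a []] := ex x y (esym e); exists a.
Qed.

Lemma cart_gfibre X Y Z (j : gmap X Z) (i : gmap Y Z) : cart (gfst j i) (gsnd j i) j i.
Proof.
split=> [[w /eqP]|x y /eqP e|[[a b] w] [[a' b'] w']] //=; last first.
  by move=> e e'; apply: val_inj; rewrite /= e e'.
by exists (exist _ (x, y) e).
Qed.

Lemma cart_exists X Y Z (j : gmap X Z) (i : gmap Y Z) :
  exists P (p : gmap P X) (q : gmap P Y), cart p q j i.
Proof. by exists (gfibre j i), (gfst j i), (gsnd j i); exact: cart_gfibre. Qed.

(*  P' -n-> P -p-> X
    |q'     |q     |j
    Y' -m-> Y -i-> Z  *)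
Section Paste.
Variables (P P' X Y Y' Z : gset G).
Variables (p : gmap P X) (q : gmap P Y) (j : gmap X Z) (i : gmap Y Z).
Variables (n : gmap P' P) (q' : gmap P' Y') (m : gmap Y' Y).
Variables (pn : gmap P' X) (im : gmap Y' Z).
Hypotheses (pnE : forall a, pn a = p (n a)) (imE : forall y, im y = i (m y)).

Lemma cart_paste : cart n q' q m -> cart p q j i -> cart pn q' j im.
Proof.
move=> [c1 ex1 inj1] [c2 ex2 inj2]; split=> [a|x y|a a'].
- by rewrite pnE imE c2 c1.
- rewrite imE => /ex2[w [<- /ex1[w' [<- <-]]]]; exists w'; by rewrite pnE.
- rewrite !pnE => pe qe; apply: inj1 => //; apply: inj2 => //.
  by rewrite !c1 qe.
Qed.

Lemma cart_cancel : (forall a, q (n a) = m (q' a)) ->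
  cart pn q' j im -> cart p q j i -> cart n q' q m.
Proof.
move=> c [c1 ex1 inj1] [c2 ex2 inj2]; split=> [//|x y e|a a' ne qe].
- have [|w [pw qw]] := ex1 (p x) y; first by rewrite c2 imE e.
  by exists w; split=> //; apply: inj2; rewrite -?pnE // c qw.
- by apply: inj1 => //; rewrite !pnE ne.
Qed.
End Paste.

Lemma cart_id X Y (f : gmap X Y) : cart (gid X) f f (gid Y).
Proof. by split=> // x y /= <-; exists x. Qed.

Lemma is_iso_bij X Y (f : gmap X Y) :
  is_iso f <-> (forall y, exists x, f x = y) /\ injective f.
Proof.
rewrite is_isoP; split=> [fu|[fs fi] y]; first split=> [y|x x' e].
- by have [x []] := fu y; exists x.
- have [y [_ yu]] := fu (f x'); exact: etrans (esym (yu x e)) (yu x' erefl).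
by have [x <-] := fs y; exists x; split=> // x' /fi.
Qed.

Lemma is_iso_inv X Y (f : gmap X Y) : is_iso f ->
  exists f' : gmap Y X, [/\ is_iso f', cancel f f' & cancel f' f].
Proof.
move=> [f' [e e']]; exists f'; split=> [|x|x]; first by exists f.
  exact: (congr1 (fun k : gmap _ _ => k x) e).
exact: (congr1 (fun k : gmap _ _ => k x) e').
Qed.

Lemma cart_iso2 P P' X Y Z (p : gmap P X) (q : gmap P Y) (p' : gmap P' X) (q' : gmap P' Y)
    (j : gmap X Z) (i : gmap Y Z) :
  cart p q j i -> cart p' q' j i ->
  exists n : gmap P P', [/\ is_iso n, forall a, p' (n a) = p a & forall a, q' (n a) = q a].
Proof.
move=> c c'; have [n [pn qn]] := cart_lift c' (cart_comm c).
exists n; split=> //; apply/is_iso_bij; split=> [a|a a' e].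
  have [w [pw qw]] := cart_ex c (cart_comm c' a).
  by exists w; apply: (cart_inj c'); rewrite ?pn ?qn.
by apply: (cart_inj c); rewrite -?pn -?qn e.
Qed.
End Cartesian.

Section Distributor.
Variable G : finGroupType.
Implicit Types P T X Y Z A B E D V : gset G.

(* The universal property of the dependent product along [j]: maps [T -> B] over
   [Z] are the maps [P -> X] over [Y], where [P] is the pullback of [T]. *)
Record dist X Y Z A B (i : gmap X Y) (j : gmap Y Z)
    (f : gmap A X) (g : gmap A B) (h : gmap B Z) : Prop := Dist {
  dist_cart : cart (gcomp i f) g j h;
  dist_lift : forall P T (a : gmap P Y) (b : gmap P T) (c : gmap T Z) (x : gmap P X),
    cart a b j c -> (forall p, i (x p) = a p) ->
    exists (m : gmap T B) (n : gmap P A),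
      [/\ forall t, h (m t) = c t, forall p, g (n p) = m (b p) & forall p, f (n p) = x p];
  dist_inj : forall b b', h b = h b' ->
    (forall a a', g a = b -> g a' = b' -> i (f a) = i (f a') -> f a = f a') -> b = b' }.

Lemma distP X Y Z A B (i : gmap X Y) (j : gmap Y Z)
    (f : gmap A X) (g : gmap A B) (h : gmap B Z) :
  is_distributor i j f g h <-> dist i j f g h.
Proof.
rewrite is_distributorP; split=> [[D1 D2 D3]|[[D1 D2 D2'] D3 D4]].
  have C : cart (gcomp i f) g j h.
    split=> // [y b e|a a' /= ia ga]; first by have [a []] := D2 _ _ e; exists a.
    have [a0 [_ u]] := D2 (g a') (i (f a')) (D1 a').
    exact: etrans (esym (u a (conj ia ga))) (u a' (conj erefl erefl)).
  split=> // [P T a b c x [jab ex inj] ix|b b' hb H].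
    have [k t m [hm Hm]|t|t m m' [hm Hm] [hm' Hm']|m mP] := @gmap_rel G T B (fun t m =>
        h m = c t /\ forall p q, b p = t -> g q = m -> i (f q) = a p -> f q = x p).
    - split=> [|p q bp gq iq]; first by rewrite !gfunJ hm.
      apply: (can_inj (gactK k^-1%g)); rewrite -!gfunJ; apply: Hm.
      + by rewrite gfunJ bp gactK.
      + by rewrite gfunJ gq gactK.
      + by rewrite !gfunJ iq.
    - pose s := [ffun y => if [pick p | (b p == t) && (a p == y)] is Some p
                           then Some (x p) else None].
      have [|m [[hm Hm] _]] := D3 (c t) s.
        apply/forallP=> y; rewrite ffunE; case: pickP => [p /andP[/eqP bp /eqP ap]|no].
          by rewrite ix ap -bp -jab ap !eqxx.
        apply/eqP=> /ex[p [ap bp]]; have := no p; by rewrite ap bp !eqxx.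
      exists m; split=> // p q bp /Hm + iq; rewrite ffunE.
      case: pickP => [p' /andP[/eqP bp' /eqP ap'] [<-]|] //.
      by congr (x _); apply: inj; rewrite ?bp ?bp' //; exact: etrans ap' iq.
    - pose s := [ffun y => if [pick p | (b p == t) && (a p == y)] is Some p
                           then Some (x p) else None].
      have sE m0 : h m0 = c t ->
          (forall p q, b p = t -> g q = m0 -> i (f q) = a p -> f q = x p) ->
          forall q, g q = m0 -> s (i (f q)) = Some (f q).
        move=> hm0 H q gq; rewrite ffunE; case: pickP => [p /andP[/eqP bp /eqP ap]|no].
          by rewrite (H p q).
        have [|p [ap bp]] := ex (i (f q)) t; first by rewrite D1 gq.
        by have := no p; rewrite ap bp !eqxx.
      have [|m0 [_ u]] := D3 (c t) s.
        apply/forallP=> y; rewrite ffunE; case: pickP => [p /andP[/eqP bp /eqP ap]|no].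
          by rewrite ix ap -bp -jab ap !eqxx.
        apply/eqP=> /ex[p [ap bp]]; have := no p; by rewrite ap bp !eqxx.
      by transitivity m0; [symmetry|]; apply: u; split=> //; apply: sE.
    have [|n [n1 n2]] := cart_lift (a := a) (b := gcomp m b) C.
      by move=> p /=; rewrite (mP _).1.
    exists m, n; split=> // [t|p]; first by case: (mP t).
    by apply: (mP (b p)).2 => //; apply: n1.
  pose s := [ffun y => if [pick q | (g q == b) && (i (f q) == y)] is Some q
                       then Some (f q) else None].
  have [|b0 [_ u]] := D3 (h b) s.
    apply/forallP=> y; rewrite ffunE; case: pickP => [q /andP[/eqP gq /eqP iq]|no].
      by rewrite -iq D1 gq !eqxx.
    apply/eqP=> /(cart_ex C)[q [/= iq gq]]; have := no q; by rewrite iq gq !eqxx.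
  transitivity b0; first symmetry; last first; apply: u; split=> // q gq; rewrite ffunE.
    case: pickP => [q' /andP[/eqP gq' /eqP iq']|no].
      by congr Some; apply: H => //; rewrite iq'.
    have [|q' [/= iq' gq']] := cart_ex (x := i (f q)) (y := b) C; first by rewrite D1 gq hb.
    by have := no q'; rewrite iq' gq' !eqxx.
  case: pickP => [q' /andP[/eqP gq' /eqP iq']|no].
    by congr (Some (f _)); apply: (cart_inj C) => //; rewrite gq gq'.
  by have := no q; rewrite gq !eqxx.
have C : cart (gcomp i f) g j h by split.
split=> // [b y /D2[a [ia ga]]|z s sP].
  by exists a; split=> // a' [ia' ga']; apply: D2'; rewrite ?ga ?ga' //= ia'.
have [m [n [hm gn fn]]] := D3 _ _ (gfst j (dprod_proj i j)) (gsnd j (dprod_proj i j)) _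
   (dprod_ev i j) (cart_gfibre _ _) (@dprod_ev_sec _ _ _ _ _ _).
have mP a (d : gdprod i j) : g a = m d -> (val d).2 (i (f a)) = Some (f a).
  move=> ga; have /eqP jw : j (i (f a)) = dprod_proj i j d by rewrite -hm -ga -D1.
  pose w : gexp i j := exist _ (i (f a), d) jw.
  have <- : n w = a.
    by apply: D2'; rewrite /= ?gn ?fn ?dprod_ev_sec.
  by rewrite fn dprod_ev_sec -dprod_evE.
pose d : gdprod i j := exist _ (z, s) sP.
exists (m d); split=> [|b [hb Hb]].
  by split=> [|a ga]; [rewrite hm | apply: (mP _ d)].
apply: D4 => [|a a' ga ga' e]; first by rewrite hm hb.
by apply: Some_inj; rewrite -(Hb a') // -e; apply/esym: (mP a d ga).
Qed.

Lemma dist_std X Y Z (i : gmap X Y) (j : gmap Y Z) :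
  dist i j (dprod_ev i j) (dprod_pi2 i j) (dprod_proj i j).
Proof.
apply/distP; exists (gid _), (gid _); split; try exact: gmapP.
  by exists (gid _); split; exact: gmapP.
by exists (gid _); split; exact: gmapP.
Qed.

Lemma dist_exists X Y Z (i : gmap X Y) (j : gmap Y Z) :
  exists A B (f : gmap A X) (g : gmap A B) (h : gmap B Z), dist i j f g h.
Proof. by do 5 eexists; exact: dist_std. Qed.

Section Unique.
Variables (X Y Z A B A' B' : gset G) (i : gmap X Y) (j : gmap Y Z).
Variables (f : gmap A X) (g : gmap A B) (h : gmap B Z).
Variables (f' : gmap A' X) (g' : gmap A' B') (h' : gmap B' Z).

Lemma dist_hom : dist i j f g h -> dist i j f' g' h' ->
  exists (m : gmap B B') (n : gmap A A'),
    [/\ is_iso m, forall b, h' (m b) = h b, forall a, g' (n a) = m (g a),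
        forall a, f' (n a) = f a & cart n g g' m].
Proof.
move=> D D'.
have [m [n [hm gn fn]]] := dist_lift (x := f) D' (dist_cart D) (fun _ => erefl).
have [m' [n' [hm' gn' fn']]] := dist_lift (x := f') D (dist_cart D') (fun _ => erefl).
have C : cart n g g' m.
  apply: (cart_cancel (p := gcomp i f') (j := j) (i := h') (pn := gcomp i f) (im := h)) => //.
  - by move=> a /=; rewrite fn.
  - exact: dist_cart D.
  - exact: dist_cart D'.
exists m, n; split=> //; apply/is_iso_bij; split=> [b|b b' e].
  exists (m' b); apply: (dist_inj D') => [|a a' ga ga' e]; first by rewrite hm hm'.
  have -> : a = n (n' a'); last by rewrite fn fn'.
  by apply: (cart_inj (dist_cart D')); rewrite /= ?gn ?gn' ?ga' // e fn fn'.
apply: (dist_inj D) => [|a a' ga ga' ia]; first by rewrite -!hm e.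
rewrite -!fn; congr (f' _); apply: (cart_inj (dist_cart D')); rewrite /= ?fn //.
by rewrite !gn ga ga' e.
Qed.
End Unique.

Lemma dist_id_l Y Z (j : gmap Y Z) : dist (gid Y) j (gid Y) j (gid Z).
Proof.
split=> [|P T a b c x C ax|//]; first by split=> // y z /= <-; exists y.
by exists c, x; split=> // p; rewrite -(cart_comm C) -ax.
Qed.

Lemma dist_id_r X Y (i : gmap X Y) : dist i (gid Y) (gid X) (gid X) i.
Proof.
split=> [|P T a b c x C ax|b b' e H]; first by split=> // y z /= ->; exists z.
  have [b' [bi b'K bK]] : exists b' : gmap T P, [/\ is_iso b, cancel b b' & cancel b' b].
    have bi : is_iso b.
      apply/is_iso_bij; split=> [t|p p' e].
        by have [p [_ <-]] := cart_ex (x := c t) (y := t) C erefl; exists p.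
      apply: (cart_inj C) => //; have := cart_comm C p; have := cart_comm C p'.
      by rewrite /= e => -> ->.
    by have [b' [? ? ?]] := is_iso_inv bi; exists b'.
  exists (gcomp x b'), x; split=> [t|p|p] //=; last by rewrite b'K.
  by rewrite ax -[RHS](congr1 c (bK t)) -(cart_comm C).
exact: H.
Qed.

Lemma dist_comp_r X Y Z1 Z2 A1 B1 A2 B2 A3
    (i : gmap X Y) (j1 : gmap Y Z1) (j2 : gmap Z1 Z2)
    (f1 : gmap A1 X) (g1 : gmap A1 B1) (h1 : gmap B1 Z1)
    (f2 : gmap A2 B1) (g2 : gmap A2 B2) (h2 : gmap B2 Z2)
    (q1 : gmap A3 A1) (q2 : gmap A3 A2) :
  dist i j1 f1 g1 h1 -> dist h1 j2 f2 g2 h2 -> cart q1 q2 g1 f2 ->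
  dist i (gcomp j2 j1) (gcomp f1 q1) (gcomp g2 q2) h2.
Proof.
move=> D1 D2 C3; have C13 : cart (gcomp (gcomp i f1) q1) q2 j1 (gcomp h1 f2).
  exact: (cart_paste (n := q1) (m := f2) _ _ C3 (dist_cart D1)).
have C : cart (gcomp i (gcomp f1 q1)) (gcomp g2 q2) (gcomp j2 j1) h2.
  apply: cart_sym.
  have := cart_paste (pn := gcomp g2 q2) (im := gcomp j2 j1) _ _ (cart_sym C13)
    (cart_sym (dist_cart D2)).
  by move=> [] // ? ? ?; split.
split=> // [P T a b c x Cp ax|b b' hb H].
  have [b1 [b1a b1b]] := cart_lift (a := gcomp j1 a) (b := b) (cart_gfibre j2 c) (cart_comm Cp).
  have C1 : cart a b1 j1 (gfst j2 c).
    apply/cart_sym; apply: (cart_cancel (pn := b) (im := gcomp j2 j1) _ _ _ (cart_sym Cp)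
      (cart_sym (cart_gfibre j2 c))) => // p; by rewrite b1b.
  have [m1 [n1 [hm1 gn1 fn1]]] := dist_lift D1 C1 ax.
  have [m2 [n2 [hm2 gn2 fn2]]] := dist_lift D2 (cart_gfibre j2 c) hm1.
  have [n [n_1 n_2]] := cart_lift (a := n1) (b := gcomp n2 b1) C3
    (fun p => etrans (gn1 p) (esym (fn2 (b1 p)))).
  exists m2, n; split=> // p /=; first by rewrite n_2 /= gn2 b1b.
  by rewrite n_1.
apply: (dist_inj D2) => // a a' ga ga' e; apply: (dist_inj D1) => // al al' gal gal' ial.
have [w [w1 w2]] := cart_ex C3 gal; have [w' [w1' w2']] := cart_ex C3 gal'.
have := H w w'; rewrite /= w1 w2 w1' w2'; exact.
Qed.

Lemma dist_comp_l V X Y Z A B V' E D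
    (l : gmap V X) (i : gmap X Y) (j : gmap Y Z)
    (f : gmap A X) (g : gmap A B) (h : gmap B Z)
    (q : gmap V' V) (l' : gmap V' A)
    (e : gmap E V') (k : gmap E D) (p : gmap D B) :
  dist i j f g h -> cart q l' l f -> dist l' g e k p ->
  dist (gcomp i l) j (gcomp q e) k (gcomp h p).
Proof.
move=> D1 CV D2.
have C : cart (gcomp (gcomp i l) (gcomp q e)) k j (gcomp h p).
  apply: (cart_paste (n := gcomp l' e) (m := p) _ _ (dist_cart D2) (dist_cart D1)) => //.
  by move=> a /=; rewrite (cart_comm CV).
split=> // [P T a b c x Cp ax|d d' hd H].
  have [m [n [hm gn fn]]] := dist_lift (x := gcomp l x) D1 Cp ax.
  have Cn : cart n b g m.
    by apply: (cart_cancel (pn := a) (im := c) _ _ gn Cp (dist_cart D1)) => [p0|t];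
      rewrite ?hm //= fn -ax.
  have [v [qv lv]] := cart_lift (a := x) (b := n) CV (fun t => esym (fn t)).
  have [m2 [n2 [hm2 gn2 fn2]]] := dist_lift D2 Cn lv.
  by exists m2, n2; split=> //= t; rewrite ?hm2 ?fn2.
have CE a t : g a = p t -> exists w, l' (e w) = a /\ k w = t.
  exact: (cart_ex (dist_cart D2)).
have pd : p d = p d'.
  apply: (dist_inj D1) => // a a' /CE[w [wa wd]] /CE[w' [wa' wd']] ia.
  rewrite -wa -wa' -!(cart_comm CV); congr (l _); apply: H => //=.
  by rewrite !(cart_comm CV) wa wa'.
apply: (dist_inj D2) => // w w' kw kw' le; apply: (cart_inj CV) => //.
by apply: H => //=; rewrite !(cart_comm CV) le.
Qed.

Lemma dist_base_change X Y Z A B X' Y' Z' A' B'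
    (i : gmap X Y) (j : gmap Y Z) (f : gmap A X) (g : gmap A B) (h : gmap B Z)
    (i' : gmap X' Y') (j' : gmap Y' Z') (f' : gmap A' X') (g' : gmap A' B') (h' : gmap B' Z')
    (xi : gmap X' X) (y : gmap Y' Y) (z : gmap Z' Z) (al : gmap A' A) (be : gmap B' B) :
  dist i j f g h -> cart y j' j z -> cart xi i' i y -> cart be h' h z -> cart al g' g be ->
  (forall a, xi (f' a) = f (al a)) -> (forall a, j' (i' (f' a)) = h' (g' a)) ->
  dist i' j' f' g' h'.
Proof.
move=> D CY CX CB CA xf jif; have yif a : y (i' (f' a)) = i (f (al a)).
  by rewrite -(cart_comm CX) xf.
have C : cart (gcomp i' f') g' j' h'.
  apply: (cart_cancel (p := y) (j := j) (i := z) (pn := gcomp (gcomp i f) al)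
    (im := gcomp h be)) => //.
  - by move=> a; rewrite /= yif.
  - by move=> b; rewrite /= (cart_comm CB).
  - exact: (cart_paste (n := al) (m := be) _ _ CA (dist_cart D)).
split=> // [P T a b c x Cp ax|b b' hb H].
  have Cp' : cart (gcomp y a) b j (gcomp z c) by apply: (cart_paste _ _ Cp CY).
  have [|m [n [hm gn fn]]] := dist_lift (x := gcomp xi x) D Cp'.
    by move=> p /=; rewrite (cart_comm CX) ax.
  have [m' [m1 m2]] := cart_lift CB hm.
  have [|n' [n1 n2]] := cart_lift (a := n) (b := gcomp m' b) CA.
    by move=> p; rewrite gn /= m1.
  exists m', n'; split=> // p; apply: (cart_inj CX); rewrite ?xf ?n1 ?fn //.
  apply: (cart_inj CY); first by rewrite yif n1 fn -(cart_comm CX).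
  by rewrite jif n2 /= m2 ax (cart_comm Cp).
apply: (cart_inj CB) => //; apply: (dist_inj D) => [|a a' ga ga' e].
  by rewrite !(cart_comm CB) hb.
have [w [w1 w2]] := cart_ex CA ga; have [w' [w1' w2']] := cart_ex CA ga'.
rewrite -w1 -w1' -!xf; congr (xi _); apply: H => //.
apply: (cart_inj CY); first by rewrite !yif w1 w1'.
by rewrite !jif w2 w2' hb.
Qed.

End Distributor.

(** * Distributors along induction *)

Section Induction.
Variables (G : finGroupType) (H : {group G}).
Implicit Types (T V D E : gset G) (W U P X Y Z : gset (subg_of H)).

Lemma cart_gres V D E T (p : gmap V D) (q : gmap V E) (j : gmap D T) (i : gmap E T) :
  cart p q j i -> cart (gres_map H p) (gres_map H q) (gres_map H j) (gres_map H i).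
Proof. by move=> [c ex inj]; split. Qed.

Lemma gind_ext X T (f f' : gmap (gind X) T) :
  (forall x, f (cls 1%g x) = f' (cls 1%g x)) -> f =1 f'.
Proof.
move=> e w; have [g [x ->]] := gindP w.
have -> : cls g x = gact g (cls 1%g x : gind X) by rewrite /= ind_act_cls mulg1.
by rewrite !gfunJ e.
Qed.

Lemma gind_mapE X Y (f : gmap X Y) g x : gind_map f (cls g x) = cls g (f x).
Proof. exact: gind_fun_cls. Qed.

Lemma gcounitE V g (v : gres H V) : gcounit H V (cls g v) = gact g (v : V).
Proof. exact: gcounit_fun_cls. Qed.

Lemma cart_gcounit D V (p : gmap D V) :
  cart (gind_map (gres_map H p)) (gcounit H D) (gcounit H V) p.
Proof.
split=> [w|w d|w w'].
- by have [g [d ->]] := gindP w; rewrite gind_mapE !gcounitE gfunJ.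
- have [g [v ->]] := gindP w; rewrite gcounitE => e.
  exists (cls g (gact g^-1%g d : gres H D)); rewrite gind_mapE gcounitE gactVK.
  by split=> //; congr cls; rewrite /= gfunJ -e gactK.
have [g [d ->]] := gindP w; have [g' [d' ->]] := gindP w'.
rewrite !gind_mapE !gcounitE => /clsP[h [gE _]] e; apply/clsP; exists h; split=> //.
by apply: (can_inj (gactK g')); rewrite -e gE gactM.
Qed.

Lemma gind_full U W Z (f : gmap W Z) (f' : gmap U Z) (psi : gmap (gind U) (gind W)) :
  (forall w, gind_map f (psi w) = gind_map f' w) ->
  exists2 psi' : gmap U W, (forall u, f (psi' u) = f' u) & forall w, psi w = gind_map psi' w.
Proof.
move=> e; have [h u w uw|u|u w w' uw uw'|psi' psi'P] :=
    @gmap_rel _ U W (fun u w => psi (cls 1%g u) = cls 1%g w).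
- have E X (x : X) : cls 1%g (gact h x) = gact (sgval h) (cls 1%g x : gind X).
    exact: gunit_subproof.
  by rewrite !E gfunJ uw.
- have := e (cls 1%g u); rewrite gind_mapE => /gind_fibre[w ? _].
  by exists w.
- by apply: (@cls_inj _ _ _ 1%g); rewrite -uw -uw'.
exists psi' => [u|]; last by apply: gind_ext => u; rewrite psi'P gind_mapE.
by apply: (@cls_inj _ _ _ 1%g); rewrite -!gind_mapE -e psi'P !gind_mapE.
Qed.
Lemma gind_slice T Y P (a : gmap T (gind Y)) (pY : gmap P Y) (pT : gmap P (gres H T)) :
  cart pY pT (gunit Y) (gres_map H a) ->
  is_iso (gcomp (gcounit H T) (gind_map pT)) /\
  forall w, a (gcounit H T (gind_map pT w)) = gind_map pY w.
Proof.
move=> C; have aE w : a (gcounit H T (gind_map pT w)) = gind_map pY w.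
  have [g [p ->]] := gindP w; rewrite !gind_mapE gcounitE gfunJ.
  have := cart_comm C p; rewrite /= => <-.
  by rewrite ind_act_cls mulg1.
split=> //; apply/is_iso_bij; split=> [t|w w' /= e].
  have [g [y at_]] := gindP (a t).
  have [|p [py pt]] := cart_ex (x := y) (y := gact g^-1%g t : gres H T) C.
    by rewrite /= gfunJ at_ /= ind_act_cls mulVg.
  by exists (cls g p); rewrite /= gind_fun_cls gcounit_fun_cls pt gactVK.
have := congr1 a e; have := aE w; have := aE w'; rewrite /= => -> ->.
have [g [p wE]] := gindP w; have [g' [p' w'E]] := gindP w'; move: e; rewrite wE w'E.
rewrite !gind_fun_cls !gcounit_fun_cls => e /clsP[h [gE yE]].
apply/clsP; exists h; split=> //; apply: (cart_inj C); rewrite ?gfunJ //.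
by apply: (can_inj (gactK g')); rewrite -e gE gactM.
Qed.

(* [D] is the pullback along [V] of the map [coind W -> coind (gres V)] of
   coinduced G-sets. *)
Record tdist V D W (f : gmap W (gres H V)) (e : gmap (gres H D) W) (p : gmap D V) : Prop :=
  TDist {
    tdist_comm : forall d, f (e d) = p d;
    tdist_lift : forall T (a : gmap T V) (b : gmap (gres H T) W), (forall t, f (b t) = a t) ->
      exists2 c : gmap T D, (forall t, p (c t) = a t) & forall t, e (c t) = b t;
    tdist_inj : forall d d' : D, p d = p d' ->
      (forall g : G, e (gact g d) = e (gact g d')) -> d = d' }.

Lemma tdistP V D W (f : gmap W (gres H V)) (e : gmap (gres H D) W) (p : gmap D V) :
  is_distributor (gind_map f) (gcounit H V) (gind_map e) (gcounit H D) p <-> tdist f e p.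
Proof.
rewrite distP; split=> [D1|[c0 l0 i0]].
  have c0 (d : D) : f (e d) = p d.
    have := cart_comm (dist_cart D1) (cls 1%g (d : gres H D)).
    by rewrite /= !gind_fun_cls !gcounit_fun_cls !gact1.
  split=> // [T a b ab|d d' pd He].
    have [|m [n [pm nm nb]]] := dist_lift (x := gind_map b) D1 (cart_gcounit a).
      by move=> w; have [g [t ->]] := gindP w; rewrite !gind_mapE ab.
    exists m => // t; have := nb (cls 1%g (t : gres H T)); rewrite gind_mapE => /gind_fibre[d nE <-].
    by have := nm (cls 1%g (t : gres H T)); rewrite nE !gcounitE !gact1 => ->.
  apply: (dist_inj D1) => // w w'.
  have [g [x ->]] := gindP w; have [g' [x' ->]] := gindP w'.
  rewrite !gind_mapE !gcounitE => xd xd' /clsP[h [gE _]].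
  apply/clsP; exists h; split=> //; rewrite -gfunJ /=.
  have -> : (x' : D) = gact g'^-1%g d' by rewrite -xd' gactK.
  by rewrite -He -xd gE gactM gactK.
have fe w : gind_map f (gind_map e w) = gind_map (gres_map H p) w.
  by have [g [d ->]] := gindP w; rewrite !gind_mapE c0.
split=> [|P T a b c x C ax|d d' pd He].
- have [c1 ex1 inj1] := cart_gcounit p; split=> [w|w d /ex1[w' [ww' dw']]|w w' ww' dd'].
  + exact: etrans (congr1 (gcounit H V) (fe w)) (c1 w).
  + by exists w'; split=> //; exact: etrans (fe w') ww'.
  by apply: inj1 => //; rewrite -!fe.
- have [phi [phii aphi bphi]] := cart_iso2 (cart_gcounit c) C.
  have [|b' fb' xb'] := @gind_full _ _ _ f (gres_map H c) (gcomp x phi).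
    by move=> w; exact: etrans (ax (phi w)) (aphi w).
  have [m pm em] := l0 _ c b' fb'.
  have [|n [an bn]] := cart_lift (a := a) (b := gcomp m b) (cart_gcounit p).
    by move=> q; rewrite (cart_comm C) /= pm.
  exists m, n; split=> // q.
  have [w <-] := ((is_iso_bij phi).1 phii).1 q.
  have -> : n (phi w) = gind_map (gres_map H m) w.
    apply: (cart_inj (cart_gcounit p)); rewrite ?an ?aphi ?bn /= ?bphi.
      by have [g [t ->]] := gindP w; rewrite !gind_fun_cls /= pm.
    by have [g [t ->]] := gindP w; rewrite /= !gind_fun_cls !gcounit_fun_cls gfunJ.
  rewrite [RHS]xb'; have [g [t ->]] := gindP w.
  by rewrite !gind_mapE /= em.
- apply: i0 => // g; apply: (@cls_inj _ _ _ g^-1%g).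
  have E (x : D) : gcounit H D (cls g^-1%g (gact g x : gres H D)) = x.
    by rewrite gcounitE gactK.
  rewrite -!gind_mapE; apply: He => //; rewrite !fe !gind_mapE; congr cls.
  by rewrite /= !gfunJ pd.
Qed.
End Induction.

(** * Quotients, coproducts and semi-Tambara functors *)

Section Quotients.
Variables (T T' : Type) (E : T -> T -> Prop) (E' : T' -> T' -> Prop).
Hypotheses (Erefl : forall x, E x x) (Esym : forall x y, E x y -> E y x)
  (Etrans : forall x y z, E x y -> E y z -> E x z).

Lemma qclassP x y : qclass E x = qclass E y <-> E x y.
Proof.
split=> [/(congr1 sval) /= e|xy]; first by rewrite e; apply: Erefl.
suff e : E x = E y by apply: eq_exist.
apply/funext => z; apply/propext; split; first exact: Etrans (Esym xy).
exact: Etrans xy.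
Qed.

Lemma qsetP (C : qset E) : exists x, C = qclass E x.
Proof. by case: C => C [x xC]; exists x; apply: eq_exist. Qed.

Definition qmap (F : T -> T') (C : qset E) : qset E' :=
  qclass E' (F (sval (cid (svalP C)))).
End Quotients.

Lemma qmapE (T T' : Type) (E : T -> T -> Prop) (E' : T' -> T' -> Prop) (F : T -> T') x :
  (forall x, E x x) -> (forall x y, E x y -> qclass E' (F x) = qclass E' (F y)) ->
  qmap E' F (qclass E x) = qclass E' (F x).
Proof.
by move=> Erefl EF; rewrite /qmap; case: cid => y /= e; apply/esym/EF; rewrite e.
Qed.

Section Sums.
Variable G : finGroupType.
Implicit Types X Y Z V : gset G.

Definition gsum_map X X' Y Y' (f : gmap X X') (f' : gmap Y Y') :
    gmap (gsum X Y) (gsum X' Y') :=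
  gcase (gcomp (ginl X' Y') f) (gcomp (ginr X' Y') f').

Definition gsum_swap X Y : gmap (gsum X Y) (gsum Y X) := gcase (ginr Y X) (ginl Y X).

Lemma cart_inl X X' Y Y' (f : gmap X X') (f' : gmap Y Y') :
  cart (ginl X Y) f (gsum_map f f') (ginl X' Y').
Proof. by split=> // [[x|y] x' //= [<-]|x x' [->]] //; exists x. Qed.

Lemma cart_inr X X' Y Y' (f : gmap X X') (f' : gmap Y Y') :
  cart (ginr X Y) f' (gsum_map f f') (ginr X' Y').
Proof. by split=> // [[x|y] y' //= [<-]|y y' [->]] //; exists y. Qed.

Lemma gsum_split X Y V V1 V2 (j : gmap V (gsum X Y)) (p1 : gmap V1 X) (q1 : gmap V1 V)
    (p2 : gmap V2 Y) (q2 : gmap V2 V) :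
  cart p1 q1 (ginl X Y) j -> cart p2 q2 (ginr X Y) j -> is_iso (gcase q1 q2).
Proof.
move=> cl cr.
have inl_inj (x x' : X) : ginl X Y x = ginl X Y x' -> x = x' by case.
have inr_inj (y y' : Y) : ginr X Y y = ginr X Y y' -> y = y' by case.
apply/is_iso_bij; split=> [v|[w|w] [w'|w']] /=.
- case jv : (j v) => [x|y].
    have [|w [_ <-]] := cart_ex (x := x) (y := v) cl => //.
    by exists (inl w).
  have [|w [_ <-]] := cart_ex (x := y) (y := v) cr => //.
  by exists (inr w).
- move=> e; congr inl; apply: (cart_inj cl) => //; apply: inl_inj.
  exact: etrans (cart_comm cl w) (etrans (congr1 j e) (esym (cart_comm cl w'))).
- by move=> e; have := etrans (cart_comm cl w) (etrans (congr1 j e) (esym (cart_comm cr w'))).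
- by move=> e; have := etrans (cart_comm cr w) (etrans (congr1 j e) (esym (cart_comm cl w'))).
- move=> e; congr inr; apply: (cart_inj cr) => //; apply: inr_inj.
  exact: etrans (cart_comm cr w) (etrans (congr1 j e) (esym (cart_comm cr w'))).
Qed.
End Sums.

Section SemiTambara.
Variables (G : finGroupType) (M : semi_tambara G).
Implicit Types X Y Z V : gset G.

Lemma gmap_eq X Y Z (f : gmap Y Z) (k : gmap X Y) (h : gmap X Z) :
  (forall x, h x = f (k x)) -> h = gcomp f k.
Proof. by move=> e; apply: gmapP. Qed.

Lemma rmapE X Y Z (f : gmap Y Z) (k : gmap X Y) (h : gmap X Z) u :
  (forall x, h x = f (k x)) -> rmap M h u = rmap M k (rmap M f u).
Proof. by move/gmap_eq->; exact: rmapM. Qed.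

Lemma rmap_eq X Y (f f' : gmap X Y) u : f =1 f' -> rmap M f u = rmap M f' u.
Proof. by move/gmapP->. Qed.

Lemma rmap_id X (f : gmap X X) u : f =1 id -> rmap M f u = u.
Proof. by move=> e; rewrite (gmapP (f := f) (f' := gid X)) ?rmap1. Qed.

Lemma tmap_id X (f : gmap X X) u : f =1 id -> tmap M f u = u.
Proof. by move=> e; rewrite (gmapP (f := f) (f' := gid X)) ?tmap1. Qed.

Lemma nmap_id X (f : gmap X X) u : f =1 id -> nmap M f u = u.
Proof. by move=> e; rewrite (gmapP (f := f) (f' := gid X)) ?nmap1. Qed.

Lemma cart_rt P X Y Z (p : gmap P X) (q : gmap P Y) (j : gmap X Z) (i : gmap Y Z) u :
  cart p q j i -> rmap M j (tmap M i u) = tmap M p (rmap M q u).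
Proof. by move/cartP/(rmap_tmap M). Qed.

Lemma cart_rn P X Y Z (p : gmap P X) (q : gmap P Y) (j : gmap X Z) (i : gmap Y Z) u :
  cart p q j i -> rmap M j (nmap M i u) = nmap M p (rmap M q u).
Proof. by move/cartP/(rmap_nmap M). Qed.

Lemma dist_nt X Y Z A B (i : gmap X Y) (j : gmap Y Z)
    (f : gmap A X) (g : gmap A B) (h : gmap B Z) u :
  dist i j f g h -> nmap M j (tmap M i u) = tmap M h (nmap M g (rmap M f u)).
Proof. by move/distP/(nmap_tmap M). Qed.

Lemma sum_ext X Y (w w' : M (gsum X Y)) :
  rmap M (ginl X Y) w = rmap M (ginl X Y) w' ->
  rmap M (ginr X Y) w = rmap M (ginr X Y) w' -> w = w'.
Proof. by move=> el er; rewrite -(pairingE w) el er pairingE. Qed.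

Lemma rmap_sum X X' Y Y' (f : gmap X X') (f' : gmap Y Y') a b :
  rmap M (gsum_map f f') (pairing a b) = pairing (rmap M f a) (rmap M f' b).
Proof.
apply: sum_ext; rewrite ?pairing_l ?pairing_r -rmapM.
  by rewrite (@rmapE _ _ _ (ginl X' Y') f) // pairing_l.
by rewrite (@rmapE _ _ _ (ginr X' Y') f') // pairing_r.
Qed.

Lemma tmap_sum X X' Y Y' (f : gmap X X') (f' : gmap Y Y') a b :
  tmap M (gsum_map f f') (pairing a b) = pairing (tmap M f a) (tmap M f' b).
Proof.
apply: sum_ext; rewrite ?pairing_l ?pairing_r.
  by rewrite (cart_rt _ (cart_sym (cart_inl f f'))) pairing_l.
by rewrite (cart_rt _ (cart_sym (cart_inr f f'))) pairing_r.
Qed.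
End SemiTambara.

Section TDist.
Variables (G : finGroupType) (H : {group G}).
Implicit Types (T V D E X Y : gset G) (W A B : gset (subg_of H)).

Lemma tdist_base_change V D V' D' W W' (f : gmap W (gres H V)) (e : gmap (gres H D) W)
    (p : gmap D V) (k : gmap V' V) (f' : gmap W' (gres H V')) (e' : gmap (gres H D') W')
    (p' : gmap D' V') (ka : gmap D' D) (k' : gmap W' W) :
  tdist f e p -> cart k' f' f (gres_map H k) -> cart ka p' p k ->
  (forall d, f' (e' d) = p' d) -> (forall d, k' (e' d) = e (ka d)) ->
  tdist f' e' p'.
Proof.
move=> [c l inj] CW CD c' ke; split=> // [T a b ab|d d' pd He].
  have [|m pm em] := l _ (gcomp k a) (gcomp k' b).
    by move=> t; rewrite /= (cart_comm CW) ab.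
  have [m' [m1 m2]] := cart_lift CD pm.
  exists m' => // t; apply: (cart_inj CW); first by rewrite ke m1 em.
  by rewrite c' m2 ab.
apply: (cart_inj CD) => //; apply: inj => [|g]; first by rewrite !(cart_comm CD) pd.
by rewrite -!gfunJ -!ke He.
Qed.

Lemma tdist_dist V X Y D E D2 E2 DV W W' A B
    (j : gmap V X) (f : gmap X Y) (i : gmap W (gres H V))
    (eW : gmap (gres H DV) W) (pV : gmap DV V)
    (e : gmap E V) (k : gmap E D) (p : gmap D Y)
    (w1 : gmap W' W) (i' : gmap W' (gres H E))
    (al : gmap A W') (be : gmap A B) (ga : gmap B (gres H D))
    (e2 : gmap E2 DV) (k2 : gmap E2 D2) (p2 : gmap D2 Y) :
  tdist i eW pV -> dist j f e k p -> cart w1 i' i (gres_map H e) ->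
  dist i' (gres_map H k) al be ga -> dist (gcomp j pV) f e2 k2 p2 ->
  exists (q : gmap D2 D) (ep : gmap (gres H D2) B) (n : gmap (gres H E2) A),
    [/\ tdist ga ep q, forall d, p (q d) = p2 d, cart n (gres_map H k2) be ep &
        forall x, w1 (al (n x)) = eW (e2 x)].
Proof.
move=> TD D1 CW DH D2'.
have [q [nq [pq knq enq]]] := dist_lift (x := gcomp pV e2) D1 (dist_cart D2') (fun _ => erefl).
have Cq : cart nq k2 k q.
  apply: (cart_cancel _ _ knq (dist_cart D2') (dist_cart D1)) => // x.
  by rewrite /= enq.
have [|x [x1 x2]] := cart_lift (a := gcomp eW (gres_map H e2)) (b := gres_map H nq) CW.
  by move=> t; rewrite /= (tdist_comm TD) enq.
have [ep [n [gep ben aln]]] := dist_lift DH (cart_gres H Cq) x2.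
have Cn : cart n (gres_map H k2) be ep.
  by apply: (cart_cancel _ _ ben (cart_gres H Cq) (dist_cart DH)) => // t /=; rewrite aln x2.
exists q, ep, n; split=> // [|t]; last by rewrite aln x1.
split=> // [T a b ab|d d' qd He].
  have [P [PE [PT CP]]] := cart_exists k a.
  have CPX : cart (gcomp (gcomp j e) PE) PT f (gcomp p a).
    exact: (cart_paste _ _ CP (dist_cart D1)).
  have [|y [y1 y2]] := cart_lift (a := gres_map H PE) (b := gcomp b (gres_map H PT))
      (dist_cart DH).
    by move=> t; rewrite /= ab (cart_comm CP).
  have Cy : cart y (gres_map H PT) be b.
    by apply: (cart_cancel _ _ y2 (cart_gres H CP) (dist_cart DH)).
  have [|c0 pc0 ec0] := tdist_lift (a := gcomp e PE) (b := gcomp w1 (gcomp al y)) TD.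
    by move=> t; rewrite /= (cart_comm CW) /=; congr (e _); exact: y1.
  have [|c [nc [pc knc enc]]] := dist_lift (x := c0) D2' CPX.
    by move=> t; rewrite /= pc0.
  have jnc w : j (e (nq (nc w))) = j (e (PE w)) by rewrite enq /= enc pc0.
  have qc t : q (c t) = a t.
    apply: (dist_inj D1) => [|x0 x0' kx kx' je]; first by rewrite pq pc.
    have [w [w1E w2E]] := cart_ex CP kx'.
    have -> : x0 = nq (nc w); last by rewrite enq /= enc pc0 /= w1E.
    apply: (cart_inj (dist_cart D1)) => /=; first by rewrite jnc je w1E.
    by rewrite kx knq knc w2E.
  have nqnc w : nq (nc w) = PE w.
    apply: (cart_inj (dist_cart D1)) => /=; first by rewrite jnc.
    by rewrite knq knc qc (cart_comm CP).
  exists c => // t; apply: (dist_inj DH) => [|x0 x0' bx bx' ix].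
    by rewrite gep ab; exact: qc.
  apply: (cart_inj CW) => //.
  have kz : k (i' (al x0)) = a t.
    by rewrite [LHS](cart_comm (dist_cart DH) x0) bx gep; exact: qc.
  have [w [w1E w2E]] := cart_ex CP kz.
  have -> : x0' = y w.
    apply: (cart_inj (dist_cart DH)); first by rewrite /= -ix -w1E; apply/esym: (y1 w).
    by rewrite bx' y2 /= w2E.
  have -> : x0 = n (nc w).
    apply: (cart_inj (dist_cart DH)); first by rewrite /= aln x2 /= nqnc.
    by rewrite bx ben /= knc w2E.
  by rewrite aln x1 /= enc ec0.
apply: (dist_inj D2') => [|x0 x0' kx kx' je]; first by rewrite -!pq qd.
have nqE : nq x0 = nq x0'.
  by apply: (cart_inj (dist_cart D1)); rewrite /= ?enq // !knq kx kx'.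
apply: (tdist_inj TD) => [|g]; first by have := enq x0; rewrite nqE enq.
have E0 z : eW (e2 z) = w1 (al (n z)) by rewrite aln x1.
rewrite -!gfunJ !E0; congr (w1 (al _)); apply: (cart_inj (dist_cart DH)).
  by rewrite /= !aln !x2 /= !gfunJ nqE.
by rewrite !ben /= !gfunJ kx kx' He.
Qed.
End TDist.

(** * The semi-Tambara functor sN R *)

Section TDistSum.
Variables (G : finGroupType) (H : {group G}).
Variables (V D V' : gset G) (W : gset (subg_of H)).

(* The identity map: the two actions agree by case analysis, not by conversion. *)
Lemma gres_sum_subproof (X Y : gset G) (h : subg_of H) (w : gres H (gsum X Y)) :
  (gact h w : gsum (gres H X) (gres H Y)) = gact h (w : gsum (gres H X) (gres H Y)).
Proof. by case: w. Qed.

Definition gres_sum (X Y : gset G) : gmap (gres H (gsum X Y)) (gsum (gres H X) (gres H Y)) :=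
  @GMap _ (gres H (gsum X Y)) (gsum (gres H X) (gres H Y)) (fun w => w)
    (@gres_sum_subproof X Y).

Lemma gres_sum_inv_subproof (X Y : gset G) (h : subg_of H) (w : gsum (gres H X) (gres H Y)) :
  (gact h w : gres H (gsum X Y)) = gact h (w : gres H (gsum X Y)).
Proof. by case: w. Qed.

Definition gres_sum_inv (X Y : gset G) :
    gmap (gsum (gres H X) (gres H Y)) (gres H (gsum X Y)) :=
  @GMap _ (gsum (gres H X) (gres H Y)) (gres H (gsum X Y)) (fun w => w)
    (@gres_sum_inv_subproof X Y).

Lemma tdist_sum (f : gmap W (gres H V)) (e : gmap (gres H D) W) (p : gmap D V) :
  tdist f e p ->
  tdist (gcomp (gres_sum_inv V V') (gsum_map f (gid (gres H V'))))
        (gcomp (gsum_map e (gid (gres H V'))) (gres_sum D V'))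
        (gsum_map p (gid V')).
Proof.
move=> [c l inj]; split=> [[d|v] //=|T a b ab|[d|v] [d'|v'] //= [pd] He].
- by rewrite c.
- have [T1 [t1 [a1 C1]]] : exists T1 (t1 : gmap T1 T) (a1 : gmap T1 V),
      cart a1 t1 (ginl V V') a.
    by exists (gfibre (ginl V V') a), (gsnd _ _), (gfst _ _); exact: cart_gfibre.
  have [h t w bw|t|t w w'|b1 b1P] :=
      @gmap_rel _ (gres H T1) W (fun t w => b (t1 t) = inl w).
  + by rewrite /= !gfunJ bw.
  + have := ab (t1 t); rewrite -[a _](cart_comm C1); case: (b _) => //= w _.
    by exists w.
  + by move=> -> [].
  have [|m pm em] := l _ a1 b1.
    move=> t; have := ab (t1 t); rewrite b1P -[a _](cart_comm C1) /=.
    by case.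
  have [h t w|t|t w w'|q qP] := @gmap_rel _ T (gsum D V') (fun t w =>
      match w with inl d => exists t0, t1 t0 = t /\ m t0 = d | inr v => a t = inr v end).
  + case: w => [d [t0 [<- <-]]|v] /=; last by rewrite gfunJ => ->.
    by exists (gact h t0); rewrite !gfunJ.
  + case at_ : (a t) => [v|v]; last by exists (inr v).
    have [|t0 [_ tt]] := cart_ex (x := v) (y := t) C1; first by rewrite at_.
    by exists (inl (m t0)), t0.
  + have N t0 v : a (t1 t0) = inr v -> False by rewrite -(cart_comm C1).
    case: w w' => [d|v] [d'|v'].
    * move=> [t0 [e0 <-]] [t0' [e0' <-]]; congr (inl (m _)).
      have e1 : t1 t0 = t1 t0' by rewrite e0.
      apply: (cart_inj C1) => //.
      have := cart_comm C1 t0; rewrite e1 -(cart_comm C1); by case.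
    * by move=> [t0 [<- _]] /N.
    * by move=> /[swap] -[t0 [<- _]] /N.
    * by move=> -> [->].
  exists q => t; have := qP t; case: (q t) => [d [t0 [<- <-]]|v av] /=.
  + by rewrite pm -(cart_comm C1).
  + by rewrite av.
  + by rewrite b1P; congr inl; exact: em.
  + have := ab t; rewrite av; by case: (b t) => //= v' [->].
- congr inl; apply: inj => // g; have := He g; by case.
- by rewrite pd.
Qed.
End TDistSum.

Section IsoSource.
Variable G : finGroupType.

Lemma is_iso_gid (X : gset G) : is_iso (gid X).
Proof. by exists (gid X); split; exact: gmapP. Qed.

Lemma cart_iso_r P X Y Y' Z (p : gmap P X) (q : gmap P Y') (j : gmap X Z)
    (i : gmap Y Z) (g : gmap Y' Y) :
  cart p q j (gcomp i g) -> is_iso g -> @cart G P X Y Z p (gcomp g q) j i.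
Proof.
move=> [c ex inj] /is_iso_bij[gs gi]; split=> // [x y|a a' pa /gi]; last exact: inj.
by have [y' <-] := gs y => /ex[a [ax ay]]; exists a; rewrite /= ay.
Qed.

Lemma dist_iso_l V V' X Y E D (j : gmap V X) (g : gmap V' V) (f : gmap X Y)
    (e : gmap E V') (k : gmap E D) (p : gmap D Y) :
  dist (gcomp j g) f e k p -> is_iso g -> @dist G V X Y E D j f (gcomp g e) k p.
Proof.
move=> [C l inj] gi; have [gV [gVi gK gVK]] := is_iso_inv gi.
split=> [|P T a b c x Cp ax|b b' e0 He].
- by case: C => ? ? ?; split.
- have [|m [n [? ? en]]] := l _ _ a b c (gcomp gV x) Cp.
    by move=> t; rewrite /= gVK.
  by exists m, n; split=> // t; rewrite /= en /= gVK.
apply: inj => // a a' ? ? ?; apply: (can_inj gK); exact: He.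
Qed.
End IsoSource.

Section SemiNormOn.
Variables (G : finGroupType) (H : {group G}) (R : semi_tambara (subg_of H)).
Implicit Types (X Y Z V D E : gset G).

Lemma pair_refl X (P : npair R X) : pair_equiv P P.
Proof. exact: rst_refl. Qed.

Lemma pair_sym X (P Q : npair R X) : pair_equiv P Q -> pair_equiv Q P.
Proof. exact: rst_sym. Qed.

Lemma pair_trans X (P Q S : npair R X) : pair_equiv P Q -> pair_equiv Q S -> pair_equiv P S.
Proof. exact: rst_trans. Qed.

Lemma sNP X (P Q : npair R X) :
  qclass (@pair_equiv G H R X) P = qclass (@pair_equiv G H R X) Q <-> pair_equiv P Q.
Proof. by apply: qclassP; [exact: pair_refl|exact: pair_sym|exact: pair_trans]. Qed.

Lemma sN_surj X (w : sN R X) : exists V (j : gmap V X) u, w = sN_class j u.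
Proof. by have [[V j u] ->] := qsetP w; exists V, j, u. Qed.

Lemma equiv_lift (R' : semi_tambara (subg_of H)) X Y (F : npair R X -> npair R' Y) :
  (forall P Q, pair_step P Q -> pair_equiv (F P) (F Q)) ->
  forall P Q, pair_equiv P Q -> pair_equiv (F P) (F Q).
Proof.
move=> FS P Q; elim=> [? ? /FS //|?|? ? _|? ? ? _ + _].
- exact: rst_refl.
- exact: rst_sym.
- exact: rst_trans.
Qed.

Lemma equiv_iso X V V' (j : gmap V X) (j' : gmap V' X) (f : gmap V' V)
    (u : R (gres H V)) (u' : R (gres H V')) :
  is_iso f -> (forall v, j' v = j (f v)) -> u' = rmap R (gres_map H f) u ->
  pair_equiv (Pair j u) (Pair j' u').
Proof.
move=> fi jf ->; apply: rst_step; apply: pair_iso fi _ erefl.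
by apply: gmapP => v /=; rewrite jf.
Qed.

Lemma equiv_transfer X V D (W : gset (subg_of H)) (j : gmap V X) (j' : gmap D X)
    (f : gmap W (gres H V)) (w : R W) (e : gmap (gres H D) W) (p : gmap D V) u u' :
  tdist f e p -> (forall d, j' d = j (p d)) -> u = tmap R f w -> u' = rmap R e w ->
  pair_equiv (Pair j u) (Pair j' u').
Proof.
move=> /tdistP D1 /gmap_eq-> -> ->; apply: rst_step; exact: pair_transfer.
Qed.

Definition npair_t X Y (f : gmap X Y) (P : npair R X) : npair R Y :=
  Pair (gcomp f (pairj P)) (pairu P).

Definition npair_r X Y (f : gmap X Y) (P : npair R Y) : npair R X :=
  Pair (gfst f (pairj P)) (rmap R (gres_map H (gsnd f (pairj P))) (pairu P)).

Definition npair_n X Y (f : gmap X Y) (P : npair R X) : npair R Y :=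
  Pair (dprod_proj (pairj P) f)
    (nmap R (gres_map H (dprod_pi2 (pairj P) f))
      (rmap R (gres_map H (dprod_ev (pairj P) f)) (pairu P))).

Lemma npair_t_equiv X Y (f : gmap X Y) P Q :
  pair_equiv P Q -> pair_equiv (npair_t f P) (npair_t f Q).
Proof.
move: P Q; apply: equiv_lift => P Q [V V' j j' g u u' gi <- <-|V D W j g w e p /tdistP D1].
  exact: equiv_iso gi _ erefl.
exact: (equiv_transfer D1 (j := gcomp f j) (j' := gcomp f (gcomp j p))).
Qed.

Lemma npair_r_cart X Y (f : gmap X Y) V V' (j : gmap V Y) u (j' : gmap V' X) (k : gmap V' V) :
  cart j' k f j -> pair_equiv (npair_r f (Pair j u)) (Pair j' (rmap R (gres_map H k) u)).
Proof.
move=> C; have [n [ni n1 n2]] := cart_iso2 C (cart_gfibre f j).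
apply: (equiv_iso ni) => [v|]; first exact/esym/n1.
by rewrite /= -rmapM; apply: rmap_eq => v; exact/esym/n2.
Qed.

Lemma npair_r_equiv X Y (f : gmap X Y) P Q :
  pair_equiv P Q -> pair_equiv (npair_r f P) (npair_r f Q).
Proof.
move: P Q; apply: equiv_lift => P Q [V V' j j' g u u' gi <- <-|V D W j g w e p /tdistP TD].
  have C := cart_iso_r (cart_gfibre f (gcomp j g)) gi.
  apply: pair_trans (npair_r_cart u C) _; apply: (equiv_iso (is_iso_gid _)) => [//|/=].
  by rewrite -!rmapM; apply: rmap_eq.
have [V' [l [k Ck]]] := cart_exists f j.
have [W' [k' [g' CW]]] := cart_exists g (gres_map H k).
have [D' [ka [p' CD]]] := cart_exists p k.
have [|e' [e1 e2]] := cart_lift (a := gcomp e (gres_map H ka)) (b := gres_map H p') CW.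
  by move=> t; rewrite /= (tdist_comm TD) (cart_comm CD).
apply: pair_trans (npair_r_cart _ Ck) _.
apply: pair_trans (equiv_transfer (j' := gcomp l p') (u' := rmap R e' (rmap R k' w)) _ _ _ _) _.
- exact: (tdist_base_change TD CW CD e2 e1).
- by [].
- exact: (cart_rt _ (cart_sym CW)).
- exact: erefl.
apply: pair_sym; have C : cart (gcomp l p') ka f (gcomp j p).
  exact: (cart_paste _ _ (cart_sym CD) Ck).
apply: pair_trans (npair_r_cart _ C) _.
apply: (equiv_iso (is_iso_gid _)) => //=; rewrite -!rmapM; apply: rmap_eq => x /=.
by rewrite e1.
Qed.

Lemma npair_n_dist X Y (f : gmap X Y) V (j : gmap V X) u E D
    (e : gmap E V) (k : gmap E D) (p : gmap D Y) :
  dist j f e k p ->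
  pair_equiv (npair_n f (Pair j u))
    (Pair p (nmap R (gres_map H k) (rmap R (gres_map H e) u))).
Proof.
move=> D1; have [m [n [mi pm kn en C]]] := dist_hom D1 (dist_std j f).
apply: (equiv_iso mi) => [d|]; first by rewrite -pm.
rewrite (cart_rn _ (cart_sym (cart_gres H C))); congr nmap.
by rewrite -rmapM; apply: rmap_eq => v; rewrite -en.
Qed.

Lemma npair_n_equiv X Y (f : gmap X Y) P Q :
  pair_equiv P Q -> pair_equiv (npair_n f P) (npair_n f Q).
Proof.
move: P Q; apply: equiv_lift => P Q [V V' j j' g u u' gi <- <-|V DV W j i w eW pV /tdistP TD].
  have [E [D [e [k [p D1]]]]] := dist_exists (gcomp j g) f.
  apply: pair_trans (npair_n_dist u (dist_iso_l D1 gi)) _.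
  apply: pair_sym; apply: pair_trans (npair_n_dist _ D1) _.
  apply: (equiv_iso (is_iso_gid _)) => //=; rewrite rmap_id //.
  by rewrite -rmapM; congr nmap; apply: rmap_eq.
have [E [D [e [k [p D1]]]]] := dist_exists j f.
have [W' [w1 [i' CW]]] := cart_exists i (gres_map H e).
have [A [B [al [be [ga DH]]]]] := dist_exists i' (gres_map H k).
have [E2 [D2 [e2 [k2 [p2 D2']]]]] := dist_exists (gcomp j pV) f.
have [q [ep [n [T1 pq Cn wn]]]] := tdist_dist TD D1 CW DH D2'.
apply: pair_trans (npair_n_dist _ D1) _.
rewrite (cart_rt _ (cart_sym CW)) (dist_nt _ DH).
apply: pair_trans (equiv_transfer (j' := p2) T1 _ erefl erefl) _ => //.
apply: pair_sym; apply: pair_trans (npair_n_dist _ D2') _.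
rewrite (cart_rn _ (cart_sym Cn)) -!rmapM.
apply: (equiv_iso (is_iso_gid _)) => //=; rewrite rmap_id //.
by congr nmap; apply: rmap_eq => x; rewrite /= wn.
Qed.

Definition npair_sum X Y (P : npair R X) (Q : npair R Y) : npair R (gsum X Y) :=
  Pair (gsum_map (pairj P) (pairj Q))
    (rmap R (gres_sum H (pairV P) (pairV Q)) (pairing (pairu P) (pairu Q))).

Lemma tmap_gres_sum_inv V V' u :
  tmap R (gres_sum_inv H V V') u = rmap R (gres_sum H V V') u.
Proof.
have {1}-> : u = rmap R (gres_sum_inv H V V') (rmap R (gres_sum H V V') u).
  by rewrite -rmapM rmap_id.
apply: tmap_rmap_iso; exists (gres_sum H V V'); split; exact: gmapP.
Qed.

Lemma npair_sum_equiv_l X Y (P P' : npair R X) (Q : npair R Y) :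
  pair_equiv P P' -> pair_equiv (npair_sum P Q) (npair_sum P' Q).
Proof.
move: P P'; apply: equiv_lift => P P' [V V' j j' g u u' gi <- <-|V D W j f w e p /tdistP TD].
  apply: (equiv_iso (f := gsum_map g (gid (pairV Q)))) => [|[v|v]|] //=.
    have [gs ginj] := (is_iso_bij g).1 gi.
    apply/is_iso_bij; split=> [[v|v]|[v|v] [v'|v'] //= []]; last by move->.
    - by have [v' <-] := gs v; exists (inl v').
    - by exists (inr v).
    - by move/ginj->.
  rewrite -[pairu Q in LHS](rmap1 R) -rmap_sum -!rmapM; apply: rmap_eq; by case.
apply: (equiv_transfer (w := pairing w (pairu Q)) (tdist_sum (pairV Q) TD)) => [[d|v]| |] //=.
  by rewrite tmapM tmap_gres_sum_inv tmap_sum tmap1.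
by rewrite -[pairu Q in LHS](rmap1 R) -rmap_sum -!rmapM.
Qed.

Lemma npair_sum_swap X Y (P : npair R X) (Q : npair R Y) :
  pair_equiv (npair_sum P Q) (npair_t (gsum_swap Y X) (npair_sum Q P)).
Proof.
apply: (equiv_iso (f := gsum_swap (pairV Q) (pairV P))) => [|[v|v]|] //=.
  by exists (gsum_swap (pairV P) (pairV Q)); split; apply: gmapP => -[].
have -> : pairing (pairu Q) (pairu P) =
    rmap R (gsum_swap (gres H (pairV Q)) (gres H (pairV P)))
      (pairing (pairu P) (pairu Q)).
  by apply: sum_ext; rewrite -rmapM ?pairing_l ?pairing_r;
    [rewrite -[LHS](pairing_r (pairu P))|rewrite -[LHS](pairing_l _ (pairu Q))];
    apply: rmap_eq.
by rewrite -!rmapM; apply: rmap_eq; case.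
Qed.

Lemma npair_sum_equiv X Y (P P' : npair R X) (Q Q' : npair R Y) :
  pair_equiv P P' -> pair_equiv Q Q' -> pair_equiv (npair_sum P Q) (npair_sum P' Q').
Proof.
move=> PP' QQ'; apply: pair_trans (npair_sum_equiv_l _ PP') _.
apply: pair_trans (npair_sum_swap _ _) _.
apply: pair_trans (npair_t_equiv _ (npair_sum_equiv_l _ QQ')) _.
exact/pair_sym/npair_sum_swap.
Qed.

Lemma npair_sum_split X Y (P : npair R (gsum X Y)) :
  pair_equiv P (npair_sum (npair_r (ginl X Y) P) (npair_r (ginr X Y) P)).
Proof.
case: P => V j u; set k := gcase (gsnd (ginl X Y) j) (gsnd (ginr X Y) j).
apply: (equiv_iso (f := k)) => [|[v|v]|]; first exact: gsum_split (cart_gfibre _ _) (cart_gfibre _ _).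
- exact: (cart_comm (cart_gfibre (ginl X Y) j)).
- exact: (cart_comm (cart_gfibre (ginr X Y) j)).
rewrite /=; set s := gres_sum _ _ _.
pose si := gres_sum_inv H (gfibre (ginl X Y) j) (gfibre (ginr X Y) j).
transitivity (rmap R s (rmap R si (rmap R (gres_map H k) u))).
  congr rmap; apply: sum_ext; rewrite ?pairing_l ?pairing_r -!rmapM; exact: rmap_eq.
by rewrite -!rmapM; apply: rmap_eq.
Qed.

Definition sN_t X Y (f : gmap X Y) : sN R X -> sN R Y :=
  qmap (@pair_equiv G H R Y) (npair_t f).
Definition sN_r X Y (f : gmap X Y) : sN R Y -> sN R X :=
  qmap (@pair_equiv G H R X) (npair_r f).
Definition sN_n X Y (f : gmap X Y) : sN R X -> sN R Y :=
  qmap (@pair_equiv G H R Y) (npair_n f).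

Lemma sN_tE X Y (f : gmap X Y) V (j : gmap V X) u :
  sN_t f (sN_class j u) = sN_class (gcomp f j) u.
Proof.
rewrite /sN_t /sN_class qmapE // => [P|P Q PQ]; first exact: pair_refl.
exact/sNP/npair_t_equiv.
Qed.

Lemma sN_rE X Y (f : gmap X Y) V (j : gmap V Y) u V' (j' : gmap V' X) (k : gmap V' V) :
  cart j' k f j -> sN_r f (sN_class j u) = sN_class j' (rmap R (gres_map H k) u).
Proof.
move=> C; rewrite /sN_r /sN_class qmapE => [|P|P Q PQ].
- exact/sNP/npair_r_cart.
- exact: pair_refl.
exact/sNP/npair_r_equiv.
Qed.

Lemma sN_nE X Y (f : gmap X Y) V (j : gmap V X) u E D
    (e : gmap E V) (k : gmap E D) (p : gmap D Y) :
  dist j f e k p ->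
  sN_n f (sN_class j u) =
    sN_class p (nmap R (gres_map H k) (rmap R (gres_map H e) u)).
Proof.
move=> D1; rewrite /sN_n /sN_class qmapE => [|P|P Q PQ].
- exact/sNP/npair_n_dist.
- exact: pair_refl.
exact/sNP/npair_n_equiv.
Qed.

Lemma sN_class_eq X V (j j' : gmap V X) (u u' : R (gres H V)) :
  j =1 j' -> u = u' -> sN_class j u = sN_class j' u'.
Proof. by move/gmapP-> => ->. Qed.

Lemma sN_coprod X Y (a : sN R X) (b : sN R Y) :
  exists! w : sN R (gsum X Y), sN_r (ginl X Y) w = a /\ sN_r (ginr X Y) w = b.
Proof.
have [V [j [u ->]]] := sN_surj a; have [V' [j' [u' ->]]] := sN_surj b.
set P := Pair j u; set Q := Pair j' u'.
exists (qclass (@pair_equiv G H R _) (npair_sum P Q)); split=> [|w].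
  rewrite !(sN_rE _ (cart_sym (cart_inl j j'))) !(sN_rE _ (cart_sym (cart_inr j j'))).
  by split; apply: sN_class_eq => //; rewrite -rmapM;
    [rewrite -[RHS](pairing_l _ u')|rewrite -[RHS](pairing_r u)]; apply: rmap_eq.
have [V0 [j0 [u0 ->]]] := sN_surj w; rewrite !(sN_rE _ (cart_gfibre _ _)).
move=> [/sNP e1 /sNP e2]; apply/sNP.
apply: pair_trans (pair_sym (npair_sum_split _)).
exact: npair_sum_equiv (pair_sym e1) (pair_sym e2).
Qed.

Definition sN_semi_on : semi_on (sN R).
Proof.
refine (@SemiOn G (sN R) sN_r sN_t sN_n _ _ _ _ _ _ _ sN_coprod _ _ _).
- move=> X; have [u] := nonempty R (gres H X); exact: inhabits (sN_class (gid X) u).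
- move=> X u; have [V [j [{}u ->]]] := sN_surj u.
  rewrite (sN_rE _ (cart_sym (cart_id j))); apply: sN_class_eq => //; exact: rmap_id.
- move=> X Y Z f k u; have [V [j [{}u ->]]] := sN_surj u.
  have [V1 [j1 [k1 C1]]] := cart_exists f j; have [V2 [j2 [k2 C2]]] := cart_exists k j1.
  rewrite (sN_rE _ C1) (sN_rE _ C2).
  rewrite (@sN_rE _ _ _ _ _ _ _ j2 (gcomp k1 k2)) -?rmapM //.
    by apply: sN_class_eq => //; exact: rmap_eq.
  exact/cart_sym/(cart_paste _ _ (cart_sym C2) (cart_sym C1)).
- move=> X u; have [V [j [{}u ->]]] := sN_surj u.
  by rewrite sN_tE; apply: sN_class_eq.
- move=> X Y Z f k u; have [V [j [{}u ->]]] := sN_surj u.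
  by rewrite !sN_tE; apply: sN_class_eq.
- move=> X u; have [V [j [{}u ->]]] := sN_surj u.
  rewrite (sN_nE _ (dist_id_r j)); apply: sN_class_eq => //.
  by rewrite nmap_id // rmap_id.
- move=> X Y Z f k u; have [V [j [{}u ->]]] := sN_surj u.
  have [A1 [B1 [f1 [g1 [h1 D1]]]]] := dist_exists j k.
  have [A2 [B2 [f2 [g2 [h2 D2]]]]] := dist_exists h1 f.
  have [A3 [q1 [q2 C3]]] := cart_exists g1 f2.
  rewrite (sN_nE _ (dist_comp_r D1 D2 C3)) (sN_nE _ D1) (sN_nE _ D2).
  apply: sN_class_eq => //; rewrite (cart_rn _ (cart_sym (cart_gres H C3))) -nmapM -rmapM.
  have -> : gres_map H (gcomp g2 q2) = gcomp (gres_map H g2) (gres_map H q2) by exact: gmapP.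
  by congr nmap; exact: rmap_eq.
- move=> P X Y Z p q j i /cartP C u; have [V [l [{}u ->]]] := sN_surj u.
  have [V' [l' [k Ck]]] := cart_exists q l.
  rewrite sN_tE (sN_rE _ Ck) sN_tE.
  apply: sN_rE; exact: (cart_paste _ _ Ck C).
- move=> P X Y Z p q j i /cartP C u; have [V [l [{}u ->]]] := sN_surj u.
  have [V' [l' [xi Cxi]]] := cart_exists q l.
  have [A [B [f [g [h D]]]]] := dist_exists l i.
  have [B' [h' [be CB]]] := cart_exists j h.
  have [A' [al [g' CA]]] := cart_exists g be.
  have [|y [py qy]] := cart_lift (a := gcomp h' g') (b := gcomp l (gcomp f al)) C.
    by move=> t; rewrite /= (cart_comm CB) -(cart_comm CA) -(cart_comm (dist_cart D)).
  have [|f' [lf' xf']] := cart_lift (a := y) (b := gcomp f al) Cxi.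
    by move=> t; rewrite qy.
  have D' : dist l' p f' g' h'.
    apply: (dist_base_change D (cart_sym C) (cart_sym Cxi) (cart_sym CB) CA) => // t.
    by rewrite lf' py.
  rewrite (sN_nE _ D) (sN_rE _ CB) (sN_rE _ Cxi) (sN_nE _ D'); apply: sN_class_eq => //.
  rewrite (cart_rn _ (cart_sym (cart_gres H CA))) -!rmapM; congr nmap.
  by apply: rmap_eq => t; rewrite /= xf'.
- move=> X Y Z A B i j f g h /distP D1 u; have [V [l [{}u ->]]] := sN_surj u.
  have [V' [l' [q CV]]] := cart_exists f l.
  have [E [D [e [k [p D2]]]]] := dist_exists l' g.
  rewrite sN_tE (sN_rE _ CV) (sN_nE _ D2) sN_tE.
  rewrite (sN_nE _ (dist_comp_l D1 (cart_sym CV) D2)); apply: sN_class_eq => //.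
  by congr nmap; rewrite -rmapM; exact: rmap_eq.
Defined.

Definition sN_std : sN_structure R :=
  @SNStructure G H R sN_semi_on
    (fun X Y f V j u => sN_tE f j u)
    (fun X Y f V j u V' j' k C => sN_rE u (proj1 (cartP j' k f j) C))
    (fun X Y f V j u E D e k p C => sN_nE u (proj1 (distP j f e k p) C)).
End SemiNormOn.

(** * Polynomial maps of commutative monoids *)

(* The hierarchy of MathComp is not available here: the values of [sN] live in
   a universe above that of [eqType]. *)
Record cmonoid := CMonoid {
  ccar :> Type;
  cadd : ccar -> ccar -> ccar;
  czero : ccar;
  caddA : forall x y z, cadd x (cadd y z) = cadd (cadd x y) z;
  caddC : forall x y, cadd x y = cadd y x;
  cadd0 : forall x, cadd czero x = x }.

Arguments cadd {c} x y : rename.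
Arguments czero {c} : rename.

Record abgroup := AbGroup {
  acar :> cmonoid;
  aopp : acar -> acar;
  aoppK : forall x, cadd (aopp x) x = czero }.

Arguments aopp {a} x : rename.

Declare Scope ab_scope.
Delimit Scope ab_scope with ab.
Local Notation "x + y" := (cadd x y) : ab_scope.
Local Notation "- x" := (aopp x) : ab_scope.
Local Notation "x - y" := (cadd x (aopp y)) : ab_scope.
Local Notation "0" := czero : ab_scope.
Local Open Scope ab_scope.

Inductive lin := LVar of nat | LZero | LAdd of lin & lin | LOpp of lin.

Fixpoint lin_signed (e : lin) : seq nat * seq nat :=
  match e with
  | LVar n => ([:: n], [::])
  | LZero => ([::], [::])
  | LAdd e1 e2 => ((lin_signed e1).1 ++ (lin_signed e2).1,
                   (lin_signed e1).2 ++ (lin_signed e2).2)%SEQ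
  | LOpp e => ((lin_signed e).2, (lin_signed e).1)
  end.

Section LinMonoid.
Variables (A : cmonoid) (env : seq A).

Fixpoint msum (s : seq nat) : A :=
  if s is n :: s' then nth 0 env n + msum s' else 0.

Lemma msum_cat s t : msum (s ++ t) = msum s + msum t.
Proof. by elim: s => [|n s IH] /=; rewrite ?cadd0 // IH caddA. Qed.

Lemma msum_perm s t : perm_eq s t -> msum s = msum t.
Proof.
elim: s t => [|n s IH] t st; first by move: st; rewrite perm_sym => /perm_nilP->.
have nt : n \in t by rewrite -(perm_mem st) mem_head.
case/splitPr: nt st => t1 t2 st.
rewrite /= (IH (t1 ++ t2)) ?msum_cat /=.
  by rewrite !caddA (caddC (nth _ _ _)).
by rewrite -(perm_cons n) (perm_trans st) // -cat1s perm_catCA.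
Qed.

Fixpoint lin_meval (e : lin) : A :=
  match e with
  | LVar n => nth 0 env n
  | LAdd e1 e2 => lin_meval e1 + lin_meval e2
  | _ => 0
  end.

Fixpoint lin_pos (e : lin) : bool :=
  match e with LAdd e1 e2 => lin_pos e1 && lin_pos e2 | LOpp _ => false | _ => true end.

Lemma lin_mevalE e : lin_pos e -> lin_meval e = msum (lin_signed e).1.
Proof.
elim: e => //= [n _|e1 IH1 e2 IH2 /andP[/IH1-> /IH2->]]; last by rewrite msum_cat.
by rewrite caddC cadd0.
Qed.

Lemma lin_mcheck e e' : lin_pos e && lin_pos e' &&
    perm_eq (lin_signed e).1 (lin_signed e').1 ->
  lin_meval e = lin_meval e'.
Proof. by case/andP=> /andP[/lin_mevalE-> /lin_mevalE->]; exact: msum_perm. Qed.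
End LinMonoid.

Section LinGroup.
Variables (B : abgroup) (env : seq B).

Fixpoint lin_eval (e : lin) : B :=
  match e with
  | LVar n => nth 0 env n
  | LZero => 0
  | LAdd e1 e2 => lin_eval e1 + lin_eval e2
  | LOpp e => - lin_eval e
  end.

Lemma cadd_cancel (x y z : B) : x + z = y + z -> x = y.
Proof.
move/(congr1 (fun w => w - z)); rewrite -!caddA (caddC z) aoppK.
by rewrite !(caddC _ 0) !cadd0.
Qed.

Lemma caddACA (A : cmonoid) (x y z t : A) : (x + y) + (z + t) = (x + z) + (y + t).
Proof. by rewrite -!caddA; congr cadd; rewrite !caddA (caddC y). Qed.

Lemma lin_evalE e :
  lin_eval e + msum env (lin_signed e).2 = msum env (lin_signed e).1.
Proof.
elim: e => /= [n||e1 IH1 e2 IH2|e <-]; rewrite ?cadd0 //.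
- by rewrite !msum_cat -IH1 -IH2 caddACA.
- by rewrite caddA aoppK cadd0.
Qed.

Lemma lin_check e e' :
    perm_eq ((lin_signed e).1 ++ (lin_signed e').2)
            ((lin_signed e').1 ++ (lin_signed e).2) ->
  lin_eval e = lin_eval e'.
Proof.
move/(msum_perm env); rewrite !msum_cat -!lin_evalE => E.
apply: (@cadd_cancel _ _ (msum env (lin_signed e).2 + msum env (lin_signed e').2)).
by rewrite caddA E -!caddA; congr cadd; rewrite caddC.
Qed.
End LinGroup.

Ltac lin_mem x l :=
  match l with
  | nil => constr:(false)
  | cons ?y ?l' =>
      match constr:((x, y)) with
      | (?z, ?z) => constr:(true)
      | _ => lin_mem x l'
      end
  end.

Ltac lin_add x l :=
  match lin_mem x l with true => l | false => constr:(cons x l) end.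

Ltac lin_atoms t l :=
  match t with
  | cadd ?a ?b => let l' := lin_atoms a l in lin_atoms b l'
  | aopp ?a => lin_atoms a l
  | czero => l
  | _ => lin_add t l
  end.

Ltac lin_index x l :=
  match l with
  | cons ?y ?l' =>
      match constr:((x, y)) with
      | (?z, ?z) => constr:(O)
      | _ => let n := lin_index x l' in constr:(S n)
      end
  end.

Ltac lin_reify t l :=
  match t with
  | cadd ?a ?b => let a' := lin_reify a l in let b' := lin_reify b l in
                  constr:(LAdd a' b')
  | aopp ?a => let a' := lin_reify a l in constr:(LOpp a')
  | czero => constr:(LZero)
  | _ => let n := lin_index t l in constr:(LVar n)
  end.

Ltac abelian :=
  match goal with
  | |- @eq ?T ?x ?y =>
      let l := lin_atoms x (@nil T) in
      let l := lin_atoms y l in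
      let e := lin_reify x l in
      let e' := lin_reify y l in
      first [ exact: (@lin_check _ l e e' isT) | exact: (@lin_mcheck _ l e e' isT) ]
  end.

Lemma aopp_uniq (B : abgroup) (x y : B) : x + y = 0 -> x = - y.
Proof. by move=> e; apply: (@cadd_cancel _ _ _ y); rewrite aoppK. Qed.

Lemma csub_eq (B : abgroup) (x y z t : B) : x + t = z + y -> x - y = z - t.
Proof.
move=> e; transitivity ((x + t) - y - t); first by abelian.
by rewrite e; abelian.
Qed.

Lemma csub0 (B : abgroup) (x : B) : x - 0 = x.
Proof. by abelian. Qed.

Lemma csubD (B : abgroup) (x y z t : B) : (x + z) - (y + t) = (x - y) + (z - t).
Proof. by abelian. Qed.

Definition additive_map (A A' : cmonoid) (f : A -> A') : Prop :=
  forall x y, f (x + y) = f x + f y.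

Lemma additive_opp (B B' : abgroup) (f : B -> B') x :
  additive_map f -> f (- x) = - f x.
Proof.
move=> fD; have f0 : f 0 = 0.
  by apply: (@cadd_cancel _ _ _ (f 0)); rewrite -fD !cadd0.
by apply: aopp_uniq; rewrite -fD aoppK.
Qed.

Fixpoint poly (A : cmonoid) (B : abgroup) (n : nat) (F : A -> B) : Prop :=
  if n is n'.+1 then forall a, poly n' (fun x => F (x + a) - F x)
  else forall x, F x = 0.

Lemma poly_ext (A : cmonoid) (B : abgroup) n (F F' : A -> B) : poly n F -> F =1 F' -> poly n F'.
Proof. by move=> PF /funext<-. Qed.

Section Poly.
Variables (A : cmonoid) (B : abgroup).
Implicit Types F : A -> B.

Lemma poly_sub n F F' : poly n F -> poly n F' -> poly n (fun x => F x - F' x).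
Proof.
elim: n F F' => [|n IH] F F' /= PF PF' => [x|a]; first by rewrite PF PF'; abelian.
by apply: (poly_ext (IH _ _ (PF a) (PF' a))) => x /=; abelian.
Qed.

Lemma poly_zero n : poly n (fun _ : A => 0 : B).
Proof.
by elim: n => //= n IH a; apply: (poly_ext IH) => x; abelian.
Qed.

Lemma poly_add n F F' : poly n F -> poly n F' -> poly n (fun x => F x + F' x).
Proof.
move=> PF PF'; apply: (poly_ext (poly_sub PF (poly_sub (poly_zero n) PF'))) => x.
by abelian.
Qed.

Lemma poly_leq m n F : (m <= n)%N -> poly m F -> poly n F.
Proof.
elim: n m F => [|n IH] [|m] F //= mn PF a; last exact: IH (PF a).
by apply: (IH 0%N) => // x; rewrite !PF; abelian.
Qed.

Lemma poly_comp_additive (A' : cmonoid) (f : A' -> A) n F :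
  additive_map f -> poly n F -> poly n (fun x => F (f x)).
Proof.
move=> fD; elim: n F => [|n IH] F //= PF a.
by apply: (poly_ext (IH _ (PF (f a)))) => x /=; rewrite fD.
Qed.

Lemma poly_shift n F c : poly n F -> poly n (fun x => F (x + c)).
Proof.
elim: n F => [|n IH] F //= PF a; apply: (poly_ext (IH _ (PF a))) => x /=.
by congr (F _ - _); abelian.
Qed.
End Poly.

Section Extension.
Variables (A : cmonoid) (Gr B : abgroup) (iota : A -> Gr).
Hypothesis iotaD : additive_map iota.
Hypothesis iota_gen : forall g, exists a b, g = iota a - iota b.
Hypothesis iota_eq : forall a b, iota a = iota b -> exists k, a + k = b + k.

Lemma poly_eq0 n (F : Gr -> B) :
  poly n F -> (forall a, F (iota a) = 0) -> forall g, F g = 0.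
Proof.
elim: n F => [|n IH] F //= PF F0 g; have [a [b ->]] := iota_gen g.
have := IH _ (PF (iota b)) _ (iota a - iota b).
have -> : iota a - iota b + iota b = iota a by abelian.
rewrite F0 => E.
have {}E : 0 - F (iota a - iota b) = 0.
  by apply: E => c; rewrite -iotaD !F0; abelian.
transitivity (0 - (0 - F (iota a - iota b))); first by abelian.
by rewrite E; abelian.
Qed.

Lemma poly_unique m n (F F' : Gr -> B) : poly m F -> poly n F' ->
  (forall a, F (iota a) = F' (iota a)) -> F =1 F'.
Proof.
move=> PF PF' FF' g.
have P := poly_sub (poly_leq (leq_maxl m n) PF) (poly_leq (leq_maxr m n) PF').
have E : F g - F' g = 0 by apply: (poly_eq0 P) => a; rewrite FF'; abelian.
transitivity ((F g - F' g) + F' g); first by abelian.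
by rewrite E; abelian.
Qed.

Lemma poly_extend n (F : A -> B) : poly n F ->
  exists2 F' : Gr -> B, poly n F' & forall a, F' (iota a) = F a.
Proof.
elim: n F => [|n IH] F /= PF.
  by exists (fun _ => 0) => // a; rewrite PF.
have /choice[D DP] (a : A) : exists Da : Gr -> B,
    poly n Da /\ forall x, Da (iota x) = F (x + a) - F x.
  by have [Da ? ?] := IH _ (PF a); exists Da.
have DD c k g : D (c + k) g = D k (g + iota c) + D c g.
  apply: (@poly_unique n n _ (fun g => D k (g + iota c) + D c g)) g => [||x].
  - exact: (DP _).1.
  - apply: poly_add (DP _).1; apply: poly_shift; exact: (DP _).1.
  - rewrite -iotaD !(DP _).2 caddA; by abelian.
pose V b c := F b - D c (iota b - iota c).
have Vk b c k : V (b + k) (c + k) = V b c.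
  rewrite /V; have -> : iota (b + k) - iota (c + k) = iota b - iota c.
    by rewrite !iotaD; abelian.
  rewrite DD; have -> : iota b - iota c + iota c = iota b by abelian.
  by rewrite (DP _).2; abelian.
have Veq b c b' c' : iota b - iota c = iota b' - iota c' -> V b c = V b' c'.
  move=> e; have [k ek] : exists k, (b + c') + k = (b' + c) + k.
    apply: iota_eq; rewrite !iotaD.
    transitivity ((iota b - iota c) + (iota c + iota c')); first by abelian.
    by rewrite e; abelian.
  rewrite -(Vk b c (c' + k)) -(Vk b' c' (c + k)); congr V; last by abelian.
  by rewrite !caddA.
have /choice[F' F'P] (g : Gr) : exists y, exists b c, g = iota b - iota c /\ y = V b c.
  have [b [c gE]] := iota_gen g.
  by exists (V b c), b, c.
have F'E b c : F' (iota b - iota c) = V b c.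
  by have [b' [c' [e ->]]] := F'P (iota b - iota c); apply: Veq.
have F'D g a : F' (g + iota a) - F' g = D a g.
  have [b [c ->]] := iota_gen g; rewrite F'E.
  have -> : iota b - iota c + iota a = iota (b + a) - iota c by rewrite iotaD; abelian.
  rewrite F'E /V; have := DD c a (iota b - iota c).
  have -> : iota b - iota c + iota c = iota b by abelian.
  rewrite (caddC c) DD (DP a).2.
  have -> : iota b - iota c + iota a = iota (b + a) - iota c by rewrite iotaD; abelian.
  move=> E; transitivity (F (b + a) - F b + D c (iota b - iota c)
      - D c (iota (b + a) - iota c)); first by abelian.
  by rewrite -E; abelian.
exists F' => [g|a]; last first.
  have -> : iota a = iota (a + a) - iota a by rewrite iotaD; abelian.
  rewrite F'E /V; have -> : iota (a + a) - iota a = iota a by rewrite iotaD; abelian.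
  by rewrite (DP _).2; abelian.
have [a [b ->]] := iota_gen g.
have P c : poly n (fun x => D c (x - iota b)) by apply: poly_shift; exact: (DP c).1.
apply: (poly_ext (poly_sub (P a) (P b))) => x.
rewrite -!F'D; have -> : x - iota b + iota a = x + (iota a - iota b) by abelian.
have -> : x - iota b + iota b = x by abelian.
by abelian.
Qed.
End Extension.

(* By induction on the degree of [Gf], then on the degree of [Phi] in its
   second argument, then in the first. *)
Lemma poly_comp_param n j k : exists N, forall (A : cmonoid) (B C : abgroup)
    (Phi : A -> B -> C) (Gf : A -> B),
  (forall x, poly j (Phi x)) -> (forall b, poly k (fun x => Phi x b)) ->
  poly n Gf -> poly N (fun x => Phi x (Gf x)).
Proof.
elim: n j k => [|n IHn] j k.
  exists k => A B C Phi Gf _ Pk G0; apply: (poly_ext (Pk 0)) => x.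
  by rewrite G0.
elim: j k => [|j IHj] k.
  by exists 0%N => A B C Phi Gf P0 _ _ x; apply: P0.
elim: k => [|k [N1 IHk]].
  by exists 0%N => A B C Phi Gf _ P0 _ x; apply: P0.
have [k' IHn'] := IHn j.+1 k.+1.
have [N2 IHj'] := IHj (maxn k' k.+1).
exists (maxn N1 N2).+1 => A B C Phi Gf Pj Pk PG a.
have P1 : poly N1 (fun x => Phi (x + a) (Gf x) - Phi x (Gf x)).
  apply: (IHk A B C (fun x b => Phi (x + a) b - Phi x b)) => // [x|b].
    by apply: poly_sub; apply: Pj.
  exact: (Pk b a).
pose K x := Gf (x + a) - Gf x.
have P2 : poly N2 (fun x => Phi (x + a) (Gf x + K x) - Phi (x + a) (Gf x)).
  apply: (IHj' A B C (fun x b => Phi (x + a) (b + K x) - Phi (x + a) b)) => // [x|b].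
    exact: (Pj (x + a) (K x)).
  apply: poly_sub.
    apply: (poly_leq (leq_maxl _ _)).
    apply: (IHn' A B C (fun x u => Phi (x + a) (b + u)) K) => [x|u|].
    - by apply: (poly_ext (poly_shift b (Pj (x + a)))) => u; congr Phi; abelian.
    - exact: (poly_shift a (Pk (b + u))).
    - exact: PG.
  apply: (poly_leq (leq_maxr _ _)); exact: (poly_shift a (Pk b)).
apply: (poly_ext (poly_add (poly_leq (leq_maxl _ N2) P1) (poly_leq (leq_maxr N1 _) P2))) => x.
have -> : Gf x + K x = Gf (x + a) by rewrite /K; abelian.
by abelian.
Qed.

Lemma poly_comp (A : cmonoid) (B C : abgroup) (F : B -> C) (Gf : A -> B) m n :
  poly m F -> poly n Gf -> exists N, poly N (fun x => F (Gf x)).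
Proof.
move=> PF PG; have [N PN] := poly_comp_param n m 1; exists N.
apply: (PN _ _ _ (fun _ => F)) => //= b a x; by abelian.
Qed.

(** * Additive completion *)

Section Additive.
Variables (G : finGroupType) (M : semi_tambara G).
Implicit Types X Y Z V A B D E : gset G.

Lemma tmap_comp_iso X Y Z (h : gmap Y Z) (f : gmap X Y) u :
  is_iso f -> tmap M (gcomp h f) (rmap M f u) = tmap M h u.
Proof. by move=> fi; rewrite tmapM tmap_rmap_iso. Qed.

Lemma nmap_comp_iso X Y Z (h : gmap Y Z) (f : gmap X Y) u :
  is_iso f -> nmap M (gcomp h f) (rmap M f u) = nmap M h u.
Proof.
move=> fi; rewrite nmapM; congr nmap.
have [f' [f'i fK f'K]] := is_iso_inv fi.
have C : cart (gid X) (gid X) f f.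
  by split=> // x x' /(can_inj fK)->; exists x'.
have E v : rmap M f (nmap M f v) = v by rewrite (cart_rn _ C) nmap1 rmap1.
by rewrite -[LHS](rmap_id (f := gcomp f f') _ f'K) rmapM E -rmapM rmap_id.
Qed.

Lemma tmap_gsum X Y Z (h : gmap (gsum X Y) Z) w :
  tmap M h w = tadd (tmap M (gcomp h (ginl X Y)) (rmap M (ginl X Y) w))
                    (tmap M (gcomp h (ginr X Y)) (rmap M (ginr X Y) w)).
Proof.
rewrite /tadd -tmap_sum pairingE -tmapM; congr (tmap M _ _).
by apply: gmapP => -[].
Qed.

Lemma taddC X (a b : M X) : tadd a b = tadd b a.
Proof.
have swi : is_iso (gsum_swap X X).
  by exists (gsum_swap X X); split; apply: gmapP => -[].
rewrite {1}/tadd -(tmap_comp_iso _ _ swi) tmap_gsum -!rmapM.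
rewrite !tmap_id //; congr tadd.
  by rewrite -[RHS](pairing_r a b); apply: rmap_eq.
by rewrite -[RHS](pairing_l a b); apply: rmap_eq.
Qed.

Lemma taddA X (a b c : M X) : tadd a (tadd b c) = tadd (tadd a b) c.
Proof.
pose f := gcase (gcomp (ginl (gsum X X) X) (ginl X X))
  (gcase (gcomp (ginl (gsum X X) X) (ginr X X)) (ginr (gsum X X) X)).
have fi : is_iso f.
  by exists (gcase (gcase (ginl X (gsum X X)) (gcomp (ginr X (gsum X X)) (ginl X X)))
      (gcomp (ginr X (gsum X X)) (ginr X X))); split; apply: gmapP; [case=> [|[]]|case=> [[]|]].
pose w := pairing (pairing a b) c; pose h := gcase (gfold X) (gid X).
have rl : rmap M (ginl X (gsum X X)) (rmap M f w) = a.
  by rewrite -rmapM (rmapE (f := ginl (gsum X X) X) (k := ginl X X)) // !pairing_l.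
have rr : rmap M (ginr X (gsum X X)) (rmap M f w) = pairing b c.
  apply: sum_ext; rewrite ?pairing_l ?pairing_r -!rmapM.
    by rewrite (rmapE (f := ginl (gsum X X) X) (k := ginr X X)) // pairing_l pairing_r.
  by rewrite (rmap_eq (f' := ginr (gsum X X) X)) // pairing_r.
transitivity (tmap M (gcomp h f) (rmap M f w)).
  rewrite tmap_gsum rl rr tmap_id //; congr tadd.
  by rewrite /tadd; congr (tmap M _ _); apply: gmapP => -[].
rewrite tmap_comp_iso // tmap_gsum pairing_l pairing_r [X in tadd _ X]tmap_id //.
by congr tadd; rewrite /tadd; congr (tmap M _ _); apply: gmapP => -[].
Qed.

Lemma tadd0 X (a : M X) : tadd (tzero M X) a = a.
Proof.
set z := inhabited_witness (nonempty M (gempty G)).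
pose h := gcase (gfrom_empty X) (gid X).
have hi : is_iso h by exists (ginr _ _); split; apply: gmapP => // -[[]|].
have E : rmap M h a = pairing z a.
  apply: sum_ext; first exact: empty_irr.
  by rewrite pairing_r -rmapM rmap_id.
rewrite -[RHS](tmap_rmap_iso a hi) E tmap_gsum pairing_l pairing_r.
by rewrite (tmap_id (f := gcomp h (ginr _ _))) //; congr (tadd (tmap M _ _) _); apply: gmapP.
Qed.

Canonical tmonoid X := CMonoid (@taddA X) (@taddC X) (@tadd0 X).

Lemma taddE X (a b : M X) : tadd a b = a + b. Proof. by []. Qed.

Lemma rmap_add X Y (f : gmap X Y) : additive_map (rmap M f).
Proof.
move=> a b; have C : cart (gfold X) (gsum_map f f) f (gfold Y).
  split=> [[]//|x [y|y] /= <-|[x|x] [x'|x'] //= ->] //; first by exists (inl x).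
  by exists (inr x).
by rewrite /cadd /= /tadd (cart_rt _ C) rmap_sum.
Qed.

Lemma tmap_add X Y (f : gmap X Y) : additive_map (tmap M f).
Proof.
move=> a b; rewrite /cadd /= /tadd -tmap_sum -!tmapM; congr (tmap M _ _).
by apply: gmapP => -[].
Qed.

Lemma rmap_zero X Y (f : gmap X Y) : rmap M f 0 = 0.
Proof.
by rewrite /czero /= /tzero (@cart_rt _ _ _ _ _ _ (gfrom_empty X) (gid _)) ?rmap1.
Qed.

Lemma tmap_zero X Y (f : gmap X Y) : tmap M f 0 = 0.
Proof.
rewrite /czero /= /tzero -tmapM; congr (tmap M _ _); by apply: gmapP => -[].
Qed.

Lemma empty_zero X (u : M X) : (X -> False) -> u = 0.
Proof.
move=> X0; have fi : is_iso (gfrom_empty X).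
  by apply/is_iso_bij; split=> [x|[]]; case: (X0 x).
rewrite -[LHS](tmap_rmap_iso u fi) /czero /= /tzero.
by congr (tmap M _ _); exact: empty_irr.
Qed.

Lemma rmap_inl_tmap_inl X Y u : rmap M (ginl X Y) (tmap M (ginl X Y) u) = u.
Proof.
rewrite (@cart_rt _ _ _ _ _ _ (gid X) (gid X)) ?tmap1 ?rmap1 //.
by split=> // x y [->]; exists y.
Qed.

Lemma rmap_inr_tmap_inl X Y u : rmap M (ginr X Y) (tmap M (ginl X Y) u) = 0.
Proof.
rewrite (@cart_rt _ _ _ _ _ _ (gfrom_empty Y) (gfrom_empty X)).
  by rewrite [rmap _ _ _]empty_zero ?tmap_zero // => -[].
by split=> // [[]|[]].
Qed.
End Additive.

Section Complement.
Variables (G : finGroupType) (Y D : gset G) (m : gmap Y D).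

Definition gcompl_car : finType := {d : D | [forall y, m y != d]}.

Lemma gcompl_act_subproof (g : G) (d : gcompl_car) : [forall y, m y != gact g (val d)].
Proof.
apply/forallP => y; apply/eqP => e; have /forallP/(_ (gact g^-1%g y))/eqP := valP d.
by case; rewrite gfunJ e gactK.
Qed.

Definition gcompl_act (g : G) (d : gcompl_car) : gcompl_car :=
  exist _ (gact g (val d)) (gcompl_act_subproof g d).

Lemma gcompl_act1 d : gcompl_act 1%g d = d.
Proof. by apply: val_inj; rewrite /= gact1. Qed.

Lemma gcompl_actM g h d : gcompl_act (g * h)%g d = gcompl_act g (gcompl_act h d).
Proof. by apply: val_inj; rewrite /= gactM. Qed.

Definition gcompl : gset G := GSet gcompl_act1 gcompl_actM.

Definition gcompl_val : gmap gcompl D :=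
  GMap (X := gcompl) (gfun := val) (fun _ _ => erefl).

Lemma gcompl_neq y (d : gcompl) : m y = gcompl_val d -> False.
Proof. by move=> e; have /forallP/(_ y)/eqP := valP d; apply. Qed.

Lemma gcompl_iso : injective m -> is_iso (gcase m gcompl_val).
Proof.
move=> mi; apply/is_iso_bij; split=> [d|[y|d] [y'|d'] /=].
- have [dP|] := boolP [forall y, m y != d]; first by exists (inr (exist _ d dP)).
  by rewrite negb_forall => /existsP[y /negPn/eqP <-]; exists (inl y).
- by move/mi->.
- by move/gcompl_neq.
- by move/esym/gcompl_neq.
- by move/val_inj->.
Qed.
End Complement.

Section NormPoly.
Variables (G : finGroupType) (M : semi_tambara G).
Implicit Types X Y Z V A B D E : gset G.

(* Expanding [n_g(x + a, c)] over the distributor for the fold map, the sections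
   choosing [x] everywhere contribute [n_g(x, c)]; on the other ones [x] occurs
   along a map with strictly smaller fibres. *)
Lemma nmap_pairing_poly (d : nat) X Y (A A' : gset G) (g : gmap (gsum A A') Y)
    (e : gmap A X) (c : M A') (C : abgroup) (th : M Y -> C) :
  additive_map th ->
  (forall y, #|[set a : A | g (inl a) == y]| < d) ->
  poly d (fun x : M X => th (nmap M g (pairing (rmap M e x) c))).
Proof.
elim: d X Y A A' g e c th => [|d IH] X Y A A' g e c th thD gd.
  move=> x; rewrite [nmap _ _ _]empty_zero => [|y]; last by have := gd y.
  by apply: (@cadd_cancel _ _ _ (th 0)); rewrite -thD !cadd0.
move=> a; pose io := gcase (ginl A A') (gid (gsum A A')).
pose w x := pairing (rmap M e x) (pairing (rmap M e a) c).
have wE x : pairing (rmap M e (x + a)) c = tmap M io (w x).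
  rewrite tmap_gsum pairing_l pairing_r [X in tadd _ X]tmap_id // taddE.
  rewrite (_ : gcomp io _ = ginl A A'); last exact: gmapP.
  apply: sum_ext; rewrite !rmap_add.
    by rewrite rmap_inl_tmap_inl !pairing_l.
  by rewrite rmap_inr_tmap_inl !pairing_r cadd0.
have [E [D [e0 [k [h D1]]]]] := dist_exists io g.
pose sec := gcase (ginl A (gsum A A')) (gcomp (ginr A (gsum A A')) (ginr A A')).
have [|m [nn [hm knn enn]]] := dist_lift (x := sec) D1 (cart_id g).
  by case.
have mi : injective m by move=> y y' my; rewrite -[y]hm my hm.
have Cn : cart nn g k m.
  by apply: (cart_cancel _ _ knn (cart_id g) (dist_cart D1)) => [p|y] /=;
    rewrite ?enn ?hm //; case: p.
pose s := gcompl_val m.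
have [E0 [k0 [s' C0]]] := cart_exists s k.
pose e1 := gcomp e0 s'.
have [E1 [p1 [q1 C1]]] := cart_exists (ginl A (gsum A A')) e1.
have [E2 [p2 [q2 C2]]] := cart_exists (ginr A (gsum A A')) e1.
have qi := gsum_split C1 C2; pose q := gcase q1 q2.
have zE x : nmap M g (tmap M io (w x)) = nmap M g (pairing (rmap M e x) c) +
    tmap M (gcomp h s) (nmap M (gcomp k0 q)
      (pairing (rmap M (gcomp e p1) x) (rmap M p2 (pairing (rmap M e a) c)))).
  rewrite (dist_nt _ D1) -(tmap_comp_iso _ _ (gcompl_iso mi)) tmap_gsum -!rmapM.
  rewrite taddE; congr cadd.
    rewrite tmap_id // (rmap_eq (f' := m)) // (cart_rn _ (cart_sym Cn)) -rmapM.
    rewrite (rmap_eq (f' := sec)) //; congr nmap.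
    apply: sum_ext; rewrite ?pairing_l ?pairing_r -rmapM.
      by rewrite (rmap_eq (f' := ginl _ _)) // pairing_l.
    rewrite (rmapE (f := ginr A (gsum A A')) (k := ginr A A')) //.
    by rewrite !pairing_r.
  rewrite (rmap_eq (f' := s)) // (cart_rn _ C0) -(nmap_comp_iso _ _ qi).
  rewrite -!rmapM (_ : gcomp _ _ = gcomp h s); last exact: gmapP.
  congr (tmap M _ (nmap M _ _)); apply: sum_ext; rewrite ?pairing_l ?pairing_r -!rmapM.
    rewrite (rmapE (f := ginl A (gsum A A')) (k := p1)) => [|u]; last exact/esym/(cart_comm C1).
    by rewrite pairing_l -rmapM.
  rewrite (rmapE (f := ginr A (gsum A A')) (k := p2)) => [|u]; last exact/esym/(cart_comm C2).
  by rewrite pairing_r.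
pose c' := rmap M p2 (pairing (rmap M e a) c).
have thsD : additive_map (fun y => th (tmap M (gcomp h s) y)).
  by move=> y y'; rewrite tmap_add thD.
suff bound d0 : #|[set u : E1 | gcomp k0 q (inl u) == d0]| < d.
  have P := IH X _ _ _ (gcomp k0 q) (gcomp e p1) c' _ thsD bound.
  apply: (poly_ext P) => x.
  by rewrite wE zE thD -/c'; abelian.
have e0q u : e0 (s' (q1 u)) = inl (p1 u) := esym (cart_comm C1 u).
have kq u : k (s' (q1 u)) = s (k0 (q1 u)) := esym (cart_comm C0 (q1 u)).
have gp u : g (inl (p1 u)) = h (s (k0 (q1 u))).
  by have := cart_comm (dist_cart D1) (s' (q1 u)); rewrite /= e0q kq.
have p1_inj u u' : k0 (q1 u) = k0 (q1 u') -> p1 u = p1 u' -> u = u'.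
  move=> ek ep; apply: (cart_inj C1) => //; apply: (cart_inj C0) => //.
  apply: (cart_inj (dist_cart D1)) => /=; first by rewrite !e0q ep.
  by rewrite !kq ek.
have /leq_trans -> // : #|[set u : E1 | gcomp k0 q (inl u) == d0]|
    < #|[set a0 : A | g (inl a0) == h (s d0)]|; last by rewrite -ltnS gd.
rewrite -(card_in_imset (f := p1)) => [|u u']; last first.
  by rewrite !inE => /eqP ku /eqP ku'; apply: p1_inj; exact: etrans ku (esym ku').
apply: proper_card; rewrite properEneq; apply/andP; split; last first.
  by apply/subsetP => _ /imsetP[u + ->]; rewrite !inE => /eqP <-; rewrite gp.
apply/eqP => /setP S; apply: (@gcompl_neq _ _ _ m (h (s d0)) d0); apply/esym.
apply: (dist_inj D1) => [|x1 x2 kx1 kx2 ix]; first by rewrite hm.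
have x2E : x2 = nn (io (e0 x2)).
  apply: (cart_inj (dist_cart D1)) => /=; first by rewrite enn; case: (e0 x2) => [|[]].
  rewrite knn kx2; congr (m _).
  by have := cart_comm (dist_cart D1) x2; rewrite /= => ->; rewrite kx2 hm.
rewrite {1}x2E enn -ix; have gi : g (io (e0 x1)) = h (s d0).
  by have := cart_comm (dist_cart D1) x1; rewrite /= => ->; rewrite kx1.
case e0x : (e0 x1) => [a0|[a0|b0]] //.
rewrite e0x /= in gi; have := S a0; rewrite !inE gi eqxx => /imsetP[u + a0E].
rewrite inE => /eqP /= k0u; have x1E : x1 = s' (q1 u).
  by apply: (cart_inj (dist_cart D1)); rewrite /= ?e0x ?e0q ?a0E // kx1 kq k0u.
by move: e0x; rewrite x1E e0q.
Qed.

Lemma nmap_poly X Y (f : gmap X Y) : exists n, forall (C : abgroup) (th : M Y -> C),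
  additive_map th -> poly n (fun x : M X => th (nmap M f x)).
Proof.
exists #|X|.+1 => C th thD; pose g := gcase f (gfrom_empty Y).
have li : is_iso (ginl X (gempty G)).
  by exists (gcase (gid X) (gfrom_empty X)); split; apply: gmapP => // -[].
pose z : M (gempty G) := 0.
apply: (poly_ext (nmap_pairing_poly (g := g) (gid X) z thD _)) => [y|x] /=.
  by rewrite ltnS max_card.
congr th; rewrite -(nmap_comp_iso _ _ li) pairing_l rmap1.
by congr nmap; exact: gmapP.
Qed.
End NormPoly.

Section Group.
Variables (G : finGroupType) (M : semi_tambara G).
Implicit Types X Y Z : gset G.

Lemma gr_diffP X (a b c d : M X) :
  gr_diff a b = gr_diff c d <-> exists k, a + d + k = c + b + k.
Proof.
apply: qclassP => [p|p q [k e]|p q r [k e] [l e']]; first by exists 0.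
  by exists k.
rewrite !taddE in e e'; exists (q.1 + q.2 + k + l); rewrite !taddE.
transitivity ((p.1 + q.2 + k) + (q.1 + r.2 + l)); first by abelian.
by rewrite e e'; abelian.
Qed.

Lemma gr_surj X (w : gr M X) : exists a b, w = gr_diff a b.
Proof. by have [[a b] ->] := qsetP w; exists a, b. Qed.

Definition gr_rep X (w : gr M X) : M X * M X := sval (cid (qsetP w)).

Definition gr_zero X : gr M X := gr_diff 0 0.
Definition gr_add X (v w : gr M X) : gr M X :=
  gr_diff ((gr_rep v).1 + (gr_rep w).1) ((gr_rep v).2 + (gr_rep w).2).
Definition gr_opp X (w : gr M X) : gr M X := gr_diff (gr_rep w).2 (gr_rep w).1.

Lemma gr_repK X (w : gr M X) : gr_diff (gr_rep w).1 (gr_rep w).2 = w.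
Proof. by rewrite /gr_rep; case: cid => -[a b] /= ->. Qed.

Lemma gr_addE X (a b c d : M X) :
  gr_add (gr_diff a b) (gr_diff c d) = gr_diff (a + c) (b + d).
Proof.
rewrite /gr_add; move: (gr_repK (gr_diff a b)) (gr_repK (gr_diff c d)).
move=> /gr_diffP[k e] /gr_diffP[l e']; apply/gr_diffP; exists (k + l).
set p := gr_rep _ in e *; set q := gr_rep _ in e' *.
transitivity ((p.1 + b + k) + (q.1 + d + l)); first by abelian.
by rewrite e e'; abelian.
Qed.

Lemma gr_oppE X (a b : M X) : gr_opp (gr_diff a b) = gr_diff b a.
Proof.
rewrite /gr_opp; move: (gr_repK (gr_diff a b)) => /gr_diffP[k e].
apply/gr_diffP; exists k; set p := gr_rep _ in e *.
transitivity (a + p.2 + k); first by abelian.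
by rewrite -e; abelian.
Qed.

Lemma gr_addA X (u v w : gr M X) : gr_add u (gr_add v w) = gr_add (gr_add u v) w.
Proof.
have [a [b ->]] := gr_surj u; have [c [d ->]] := gr_surj v.
by have [e [f ->]] := gr_surj w; rewrite !gr_addE !caddA.
Qed.

Lemma gr_addC X (u v : gr M X) : gr_add u v = gr_add v u.
Proof.
have [a [b ->]] := gr_surj u; have [c [d ->]] := gr_surj v.
by rewrite !gr_addE (caddC a) (caddC b).
Qed.

Lemma gr_add0 X (u : gr M X) : gr_add (gr_zero X) u = u.
Proof. by have [a [b ->]] := gr_surj u; rewrite gr_addE !cadd0. Qed.

Canonical gr_monoid X := CMonoid (@gr_addA X) (@gr_addC X) (@gr_add0 X).

Lemma gr_addN X (u : gr M X) : gr_opp u + u = 0.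
Proof.
have [a [b ->]] := gr_surj u; rewrite gr_oppE [LHS]gr_addE.
by apply/gr_diffP; exists 0; abelian.
Qed.

Canonical gr_group X := AbGroup (@gr_addN X).

Lemma gr_diffD X (a b c d : M X) : gr_diff a b + gr_diff c d = gr_diff (a + c) (b + d).
Proof. exact: gr_addE. Qed.

Lemma to_gr_add X : additive_map (@to_gr G M X).
Proof. by move=> a b; rewrite gr_diffD cadd0. Qed.

Lemma gr_diffE X (a b : M X) : gr_diff a b = to_gr a - to_gr b.
Proof. by rewrite /aopp /= gr_oppE gr_diffD cadd0 caddC cadd0. Qed.

Lemma gr_gen X (w : gr M X) : exists a b, w = to_gr a - to_gr b.
Proof. by have [a [b ->]] := gr_surj w; exists a, b; exact: gr_diffE. Qed.

Lemma to_gr_eq X (a b : M X) : to_gr a = to_gr b -> exists k, a + k = b + k.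
Proof. by move=> /gr_diffP[k e]; exists k; move: e; rewrite !(caddC _ 0) !cadd0. Qed.

End Group.

Definition polynomial (A : cmonoid) (B : abgroup) (F : A -> B) : Prop :=
  exists n, poly n F.

Lemma additive_polynomial (A : cmonoid) (B : abgroup) (F : A -> B) :
  additive_map F -> polynomial F.
Proof.
move=> FD; exists 2 => a b x; rewrite !FD; by abelian.
Qed.

Lemma polynomial_comp (A : cmonoid) (B C : abgroup) (F : B -> C) (F' : A -> B) :
  polynomial F -> polynomial F' -> polynomial (fun x => F (F' x)).
Proof. by move=> [m PF] [n PF']; exact: poly_comp PF PF'. Qed.

Section Completion.
Variables (G : finGroupType) (M : semi_tambara G).
Implicit Types X Y Z : gset G.

Lemma gr_ext X (B : abgroup) (F F' : gr M X -> B) :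
  polynomial F -> polynomial F' -> (forall a, F (to_gr a) = F' (to_gr a)) -> F =1 F'.
Proof.
move=> [m PF] [n PF']; exact: (poly_unique (@to_gr_add G M X) (@gr_gen G M X) PF PF').
Qed.

Definition gr_lift X Y (phi : M X -> M Y) (w : gr M X) : gr M Y :=
  gr_diff (phi (gr_rep w).1) (phi (gr_rep w).2).

Lemma gr_liftE X Y (phi : M X -> M Y) a b :
  additive_map phi -> gr_lift phi (gr_diff a b) = gr_diff (phi a) (phi b).
Proof.
move=> pD; have := gr_repK (gr_diff a b); set p := gr_rep _ => /gr_diffP[k e].
rewrite /gr_lift -/p; apply/gr_diffP; exists (phi k); by rewrite -!pD e.
Qed.

Lemma gr_lift_add X Y (phi : M X -> M Y) : additive_map phi -> additive_map (gr_lift phi).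
Proof.
move=> pD u v; have [a [b ->]] := gr_surj u; have [c [d ->]] := gr_surj v.
by rewrite gr_diffD !gr_liftE // gr_diffD !pD.
Qed.

Lemma gr_lift_to_gr X Y (phi : M X -> M Y) a :
  additive_map phi -> phi 0 = 0 -> gr_lift phi (to_gr a) = to_gr (phi a).
Proof. by move=> pD p0; rewrite gr_liftE // p0. Qed.

Lemma gr_norm_exists X Y (f : gmap X Y) : exists F : gr M X -> gr M Y,
  polynomial F /\ forall a, F (to_gr a) = to_gr (nmap M f a).
Proof.
have [n Pn] := nmap_poly M f.
have [F PF FE] := poly_extend (@to_gr_add G M X) (@gr_gen G M X) (@to_gr_eq G M X)
  (Pn _ _ (@to_gr_add G M Y)).
by exists F; split=> //; exists n.
Qed.

Definition gr_norm X Y (f : gmap X Y) : gr M X -> gr M Y := sval (cid (gr_norm_exists f)).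

Lemma gr_norm_poly X Y (f : gmap X Y) : polynomial (gr_norm f).
Proof. by rewrite /gr_norm; case: cid => F []. Qed.

Lemma gr_normE X Y (f : gmap X Y) a : gr_norm f (to_gr a) = to_gr (nmap M f a).
Proof. by rewrite /gr_norm; case: cid => F []. Qed.

Definition gr_r X Y (f : gmap X Y) := gr_lift (rmap M f).
Definition gr_t X Y (f : gmap X Y) := gr_lift (tmap M f).

Lemma gr_rE X Y (f : gmap X Y) a b :
  gr_r f (gr_diff a b) = gr_diff (rmap M f a) (rmap M f b).
Proof. exact/gr_liftE/rmap_add. Qed.

Lemma gr_tE X Y (f : gmap X Y) a b :
  gr_t f (gr_diff a b) = gr_diff (tmap M f a) (tmap M f b).
Proof. exact/gr_liftE/tmap_add. Qed.

Lemma gr_r_to_gr X Y (f : gmap X Y) a : gr_r f (to_gr a) = to_gr (rmap M f a).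
Proof. exact: (gr_lift_to_gr _ (@rmap_add _ _ _ _ f) (rmap_zero M f)). Qed.

Lemma gr_t_to_gr X Y (f : gmap X Y) a : gr_t f (to_gr a) = to_gr (tmap M f a).
Proof. exact: (gr_lift_to_gr _ (@tmap_add _ _ _ _ f) (tmap_zero M f)). Qed.

Lemma gr_r_poly X Y (f : gmap X Y) : polynomial (gr_r f).
Proof. exact/additive_polynomial/gr_lift_add/rmap_add. Qed.

Lemma gr_t_poly X Y (f : gmap X Y) : polynomial (gr_t f).
Proof. exact/additive_polynomial/gr_lift_add/tmap_add. Qed.

Lemma gr_coprod X Y (a : gr M X) (b : gr M Y) :
  exists! w : gr M (gsum X Y), gr_r (ginl X Y) w = a /\ gr_r (ginr X Y) w = b.
Proof.
have [a1 [a2 ->]] := gr_surj a; have [b1 [b2 ->]] := gr_surj b.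
exists (gr_diff (pairing a1 b1) (pairing a2 b2)); split=> [|w].
  by rewrite !gr_rE !pairing_l !pairing_r.
have [c1 [c2 ->]] := gr_surj w; rewrite !gr_rE => -[/gr_diffP[k ek] /gr_diffP[l el]].
apply/gr_diffP; exists (pairing k l); apply: sum_ext; rewrite !rmap_add.
  by rewrite !pairing_l ek.
by rewrite !pairing_r el.
Qed.

Definition gr_semi_on : semi_on (gr M).
Proof.
refine (@SemiOn G (gr M) gr_r gr_t gr_norm (fun X => inhabits (0 : gr M X))
  _ _ _ _ _ _ gr_coprod _ _ _).
- by move=> X u; have [a [b ->]] := gr_surj u; rewrite gr_rE !rmap1.
- by move=> X Y Z f k u; have [a [b ->]] := gr_surj u; rewrite !gr_rE !rmapM.
- by move=> X u; have [a [b ->]] := gr_surj u; rewrite gr_tE !tmap1.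
- by move=> X Y Z f k u; have [a [b ->]] := gr_surj u; rewrite !gr_tE !tmapM.
- move=> X u; apply: (gr_ext (F' := id)); first exact: gr_norm_poly.
    exact: additive_polynomial.
  by move=> a; rewrite gr_normE nmap1.
- move=> X Y Z f k u; apply: (gr_ext (F' := fun v => gr_norm f (gr_norm k v))).
  + exact: gr_norm_poly.
  + exact: polynomial_comp (gr_norm_poly f) (gr_norm_poly k).
  by move=> a; rewrite !gr_normE nmapM.
- move=> P X Y Z p q j i /(rmap_tmap M) E u; have [a [b ->]] := gr_surj u.
  by rewrite gr_tE !gr_rE gr_tE !E.
- move=> P X Y Z p q j i /(rmap_nmap M) E u.
  apply: (gr_ext (F := fun v => gr_r j (gr_norm i v)) (F' := fun v => gr_norm p (gr_r q v))).
  + exact: polynomial_comp (gr_r_poly j) (gr_norm_poly i).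
  + exact: polynomial_comp (gr_norm_poly p) (gr_r_poly q).
  by move=> a; rewrite gr_normE !gr_r_to_gr gr_normE E.
- move=> X Y Z A B i j f g h /(nmap_tmap M) E u.
  apply: (gr_ext (F := fun v => gr_norm j (gr_t i v))
    (F' := fun v => gr_t h (gr_norm g (gr_r f v)))).
  + exact: polynomial_comp (gr_norm_poly j) (gr_t_poly i).
  + apply: polynomial_comp (gr_t_poly h) _.
    exact: polynomial_comp (gr_norm_poly g) (gr_r_poly f).
  by move=> a; rewrite gr_r_to_gr gr_t_to_gr !gr_normE gr_t_to_gr E.
Defined.

Section Any.
Variable K : semi_on (gr M).
Hypotheses (rK : forall X Y (f : gmap X Y) a b,
    rmap K f (gr_diff a b) = gr_diff (rmap M f a) (rmap M f b))
  (tK : forall X Y (f : gmap X Y) a b,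
    tmap K f (gr_diff a b) = gr_diff (tmap M f a) (tmap M f b)).

Lemma tadd_gr X (u v : gr M X) : @tadd _ (SemiTambara K) X u v = u + v.
Proof.
have [a [b ->]] := gr_surj u; have [c [d ->]] := gr_surj v.
rewrite gr_diffD /tadd.
have -> : @pairing _ (SemiTambara K) X X (gr_diff a b) (gr_diff c d)
    = gr_diff (pairing a c) (pairing b d).
  apply: (@sum_ext _ (SemiTambara K)); rewrite rK.
    by rewrite (@pairing_l _ (SemiTambara K)) !pairing_l.
  by rewrite (@pairing_r _ (SemiTambara K)) !pairing_r.
by rewrite tK.
Qed.

Lemma tzero_gr X : tzero (SemiTambara K) X = @czero (gr_monoid M X).
Proof.
rewrite {1}/tzero; set w := inhabited_witness _.
have -> : w = gr_diff 0 0 by exact: (@empty_irr _ (SemiTambara K)).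
by rewrite tK !tmap_zero.
Qed.

Lemma gr_is_tambara : is_tambara (SemiTambara K).
Proof. by move=> X a; exists (- (a : gr M X)); rewrite tadd_gr tzero_gr caddC aoppK. Qed.
End Any.

Definition completion_std : completion_structure M :=
  @CompletionStructure G M gr_semi_on (gr_is_tambara (K := gr_semi_on) gr_rE gr_tE)
    gr_rE gr_tE gr_normE.
End Completion.

Section TambaraGroup.
Variables (G : finGroupType) (R : tambara G) (X : gset G).

Definition topp (a : R X) : R X := sval (cid (tambaraP a)).

Lemma toppK (a : R X) : topp a + a = 0.
Proof. by rewrite caddC /topp; case: cid. Qed.

Definition tgroup := AbGroup toppK.
End TambaraGroup.

Section SMorph.
Variables (G : finGroupType) (M N : semi_tambara G) (phi : smorph M N).

Lemma smorph_pairing X Y (a : M X) (b : M Y) :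
  phi _ (pairing a b) = pairing (phi X a) (phi Y b).
Proof. by apply: sum_ext; rewrite -smapR ?pairing_l ?pairing_r. Qed.

Lemma smorph_add X : additive_map (phi X).
Proof. by move=> a b; rewrite -!taddE /tadd smapT smorph_pairing. Qed.

Lemma smorph_zero X : phi X 0 = 0.
Proof. by rewrite /czero /= /tzero smapT; congr (tmap N _ _); exact: empty_irr. Qed.
End SMorph.

Section CompletionUniversal.
Variables (G : finGroupType) (M : semi_tambara G) (K : completion_structure M).

Lemma completion_tadd X (u v : gr M X) : @tadd _ (completion K) X u v = u + v.
Proof. exact: (tadd_gr (@rmap_gr _ _ K) (@tmap_gr _ _ K)). Qed.

Lemma completion_add_id X :
  @additive_map (gr_monoid M X) (tmonoid (completion K) X) (fun u => u).
Proof. by move=> u v; exact/esym/completion_tadd. Qed.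

Definition to_completion : smorph M (completion K).
Proof.
refine (@SMorph G M (completion K) (@to_gr G M) _ _ _) => X Y f u.
- by rewrite [RHS](rmap_gr K) rmap_zero.
- by rewrite [RHS](tmap_gr K) tmap_zero.
- by rewrite [RHS](nmap_gr K).
Defined.

Lemma completion_ext (R : tambara G) (psi psi' : smorph (completion K) R) :
  (forall X a, psi X (to_gr a) = psi' X (to_gr a)) -> psi = psi'.
Proof.
move=> e; apply: smorphP => X w; have [a [b ->]] := gr_surj w.
apply: (@cadd_cancel (tgroup R X) _ _ (psi X (to_gr b))).
have E : @cadd (tmonoid (completion K) X) (gr_diff a b) (to_gr b) = to_gr a.
  rewrite [LHS]completion_tadd gr_diffD; apply/gr_diffP; exists 0; abelian.
by rewrite {2}e -!smorph_add E e.
Qed.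

Section Extend.
Variables (R : tambara G) (phi : smorph M R).

Definition extend_fun X (w : gr M X) : R X :=
  @cadd (tgroup R X) (phi X (gr_rep w).1) (@aopp (tgroup R X) (phi X (gr_rep w).2)).

Lemma extend_funE X (a b : M X) :
  extend_fun (gr_diff a b) = @cadd (tgroup R X) (phi X a) (@aopp (tgroup R X) (phi X b)).
Proof.
have := gr_repK (gr_diff a b); rewrite /extend_fun; set p := gr_rep _ => /gr_diffP[k].
move/(congr1 (phi X)); rewrite !smorph_add.
move/(@cadd_cancel (tgroup R X)); exact: csub_eq.
Qed.

Lemma extend_to_gr X (a : M X) : extend_fun (to_gr a) = phi X a.
Proof.
rewrite extend_funE smorph_zero; exact: (@csub0 (tgroup R X)).
Qed.

Lemma extend_add X : @additive_map (gr_monoid M X) (tgroup R X) (@extend_fun X).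
Proof.
move=> u v; have [a [b ->]] := gr_surj u; have [c [d ->]] := gr_surj v.
rewrite gr_diffD !extend_funE !smorph_add; exact: (@csubD (tgroup R X)).
Qed.

Definition extend : smorph (completion K) R.
Proof.
refine (@SMorph G (completion K) R extend_fun _ _ _) => X Y f u.
- have [a [b ->]] := gr_surj u; rewrite [rmap (completion K) _ _](rmap_gr K).
  rewrite !extend_funE !smapR (rmap_add (M := R) f).
  by rewrite (@additive_opp (tgroup R Y) (tgroup R X)) //; exact: rmap_add.
- have [a [b ->]] := gr_surj u; rewrite [tmap (completion K) _ _](tmap_gr K).
  rewrite !extend_funE !smapT (tmap_add (M := R) f).
  by rewrite (@additive_opp (tgroup R X) (tgroup R Y)) //; exact: tmap_add.
apply: (@gr_ext G M X (tgroup R Y) (fun u => extend_fun (nmap (completion K) f u))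
   (fun u => nmap R f (extend_fun u))) => [||a].
- have [n Pn] := nmap_poly (completion K) f; exists n.
  refine (@poly_comp_additive (tmonoid (completion K) X) (tgroup R Y) _ _ n
    (fun u => extend_fun (nmap (completion K) f u)) (@completion_add_id X) _).
  apply: (Pn (tgroup R Y) (@extend_fun Y)) => v w.
  exact: etrans (congr1 (@extend_fun Y) (completion_tadd v w)) (extend_add v w).
- have [n Pn] := nmap_poly R f; exists n.
  refine (@poly_comp_additive (tmonoid R X) (tgroup R Y) _ _ n
    (nmap R f) (@extend_add X) _).
  exact: (Pn (tgroup R Y) (fun v => v)).
by rewrite [nmap (completion K) _ _](nmap_gr K) !extend_to_gr smapN.
Defined.
End Extend.
End CompletionUniversal.

(** * The adjunction *)

Section UnitGeometry.
Variables (G : finGroupType) (H : {group G}).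
Implicit Types (T V : gset G) (X Y A B P : gset (subg_of H)).

Lemma cart_gunit X Y (f : gmap X Y) :
  cart f (gunit X) (gunit Y) (gres_map H (gind_map f)).
Proof.
split=> [x|y w /esym/gind_fibre[x -> <-]|x x' _]; last exact: cls_inj.
  by rewrite /= gind_fun_cls.
by exists x.
Qed.

Lemma tdist_gind X Y A B (f : gmap X Y) (al : gmap A X) (be : gmap A B)
    (ga : gmap B (gres H (gind Y))) :
  dist f (gunit Y) al be ga ->
  exists (e : gmap (gres H (gind X)) B) (n : gmap X A),
    [/\ tdist ga e (gind_map f), cart n (gunit X) be e & forall x, al (n x) = x].
Proof.
move=> D1; have [e [n [gae ben aln]]] :=
  dist_lift (x := gid X) D1 (cart_gunit f) (fun _ => erefl).
have {}aln (x : X) : al (n x) = x by exact: aln.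
have Cn : cart n (gunit X) be e.
  by apply: (cart_cancel _ _ ben (cart_gunit f) (dist_cart D1)) => // x /=; rewrite aln.
exists e, n; split=> //; split=> // [T a b ab|w w' fw He].
  have [P [pY [pT CP]]] := cart_exists (gunit Y) (gres_map H a).
  have [si sa] := gind_slice CP.
  have [phi [_ phiK Kphi]] := is_iso_inv si.
  have [|y [y1 y2]] := cart_lift (a := pY) (b := gcomp b pT) (dist_cart D1).
    by move=> p; rewrite (cart_comm CP) /= ab.
  pose x := gcomp al y; have fx w : gind_map f (gind_map x w) = gind_map pY w.
    have [g [p ->]] := gindP w; rewrite !gind_mapE; congr cls; exact: y1.
  exists (gcomp (gind_map x) phi) => t; first by rewrite [LHS]fx -sa; congr (a _); exact: Kphi.
  apply: (dist_inj D1) => [|x0 x0' bx bx' fx0].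
    by rewrite gae ab [LHS]fx -sa; congr (a _); exact: Kphi.
  have at_ : gunit Y (f (al x0')) = a t.
    by rewrite [LHS](cart_comm (dist_cart D1)) bx' ab.
  have [p [p1 p2]] := cart_ex CP at_.
  have x0'E : x0' = y p.
    by apply: (cart_inj (dist_cart D1)); rewrite ?y1 ?y2 /= ?bx' ?p2 ?p1.
  have phit : phi t = cls 1%g p.
    rewrite -p2 -[RHS]phiK; congr (phi _).
    by rewrite /= gind_fun_cls gcounit_fun_cls gact1.
  have -> : x0 = n (x p); last by rewrite aln x0'E.
  apply: (cart_inj (dist_cart D1)); rewrite /= ?aln; first by rewrite fx0 x0'E.
  by rewrite bx ben; congr (e _); rewrite /= phit gind_fun_cls.
have [g [x wE]] := gindP w; move: fw; rewrite wE gind_mapE.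
move=> /esym/gind_fibre[x' w'E fx]; rewrite w'E; congr cls.
have E (z : X) : gact g^-1%g (cls g z : gind X) = gunit X z.
  by rewrite /= ind_act_cls mulVg.
have := He g^-1%g; rewrite wE w'E !E -!ben => nx.
rewrite -(aln x) -(aln x'); congr (al _).
by apply: (cart_inj (dist_cart D1)) => //=; rewrite !aln.
Qed.
End UnitGeometry.

Section SemiNormUnit.
Variables (G : finGroupType) (H : {group G}) (R : semi_tambara (subg_of H)).
Variable S : sN_structure R.
Implicit Types X Y : gset (subg_of H).

Definition sN_unit_fun X (u : R X) : res_semi H (sN_semi S) X :=
  sN_class (gid (gind X)) (nmap R (gunit X) u).

Definition sN_unit : smorph R (res_semi H (sN_semi S)).
Proof.
refine (@SMorph _ R (res_semi H (sN_semi S)) sN_unit_fun _ _ _) => X Y f u.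
- rewrite [RHS](rmap_sN S _ ((cartP _ _ _ _).2 (cart_id (gind_map f)))).
  by apply: sN_class_eq => //; rewrite (cart_rn _ (cart_sym (cart_gunit f))).
- rewrite [RHS](tmap_sN S).
  have [A [B [al [be [ga D1]]]]] := dist_exists f (gunit Y).
  have [e [n [TD Cn aln]]] := tdist_gind D1.
  apply/sNP; apply: (equiv_transfer TD) => //; first exact: (dist_nt _ D1).
  by rewrite (cart_rn _ (cart_sym Cn)) -rmapM rmap_id.
rewrite [RHS](nmap_sN S _ ((distP _ _ _ _ _).2 (dist_id_l (gind_map f)))).
apply: sN_class_eq => //; rewrite (rmap_id (f := gres_map H (gid _))) // -!nmapM; congr nmap.
by apply: gmapP => x; exact: (cart_comm (cart_gunit f)).
Defined.
End SemiNormUnit.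

Section SemiNormMap.
Variables (G : finGroupType) (H : {group G}) (R R' : semi_tambara (subg_of H)).
Variables (S : sN_structure R) (S' : sN_structure R') (phi : smorph R R').

Definition npair_map (X : gset G) (P : npair R X) : npair R' X :=
  Pair (pairj P) (phi _ (pairu P)).

Lemma npair_map_equiv X (P Q : npair R X) :
  pair_equiv P Q -> pair_equiv (npair_map P) (npair_map Q).
Proof.
move: P Q; apply: equiv_lift => P Q [V V' j j' g u u' gi <- <-|V D W j g w e p /tdistP D1].
  by apply: (equiv_iso gi) => //=; rewrite smapR.
by apply: (equiv_transfer D1) => //=; rewrite ?smapT ?smapR.
Qed.

Definition sN_map_fun (X : gset G) : sN R X -> sN R' X :=
  qmap (@pair_equiv G H R' X) (@npair_map X).

Lemma sN_mapE X V (j : gmap V X) (u : R (gres H V)) :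
  sN_map_fun (sN_class j u) = sN_class j (phi _ u).
Proof.
rewrite /sN_map_fun /sN_class qmapE // => [P|P Q PQ]; first exact: pair_refl.
exact/sNP/npair_map_equiv.
Qed.

Definition sN_map : smorph (sN_semi S) (sN_semi S').
Proof.
refine (@SMorph G (sN_semi S) (sN_semi S') sN_map_fun _ _ _) => X Y f w;
  have [V [j [u ->]]] := sN_surj w.
- have [V' [j' [k /cartP C]]] := cart_exists f j.
  rewrite [rmap _ _ _](rmap_sN S _ C) !sN_mapE [RHS](rmap_sN S' _ C).
  by apply: sN_class_eq => //; rewrite smapR.
- by rewrite [tmap _ _ _](tmap_sN S) !sN_mapE [RHS](tmap_sN S').
have [E [D [e [k [p /distP D1]]]]] := dist_exists j f.
rewrite [nmap _ _ _](nmap_sN S _ D1) !sN_mapE [RHS](nmap_sN S' _ D1).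
by apply: sN_class_eq => //; rewrite smapN smapR.
Defined.
End SemiNormMap.

Section SemiNormCounit.
Variables (G : finGroupType) (H : {group G}) (R : semi_tambara G).
Variable S : sN_structure (res_semi H R).
Implicit Types X Y V : gset G.

Definition npair_val X (P : npair (res_semi H R) X) : R X :=
  tmap R (pairj P) (nmap R (gcounit H (pairV P)) (pairu P)).

Lemma npair_val_equiv X (P Q : npair (res_semi H R) X) :
  pair_equiv P Q -> npair_val P = npair_val Q.
Proof.
elim=> [{}P {}Q [V V' j j' f u u' fi <- <-|V D W j f w e p D1]|//|? ? _ -> //|? ? ? _ -> _ -> //].
  rewrite /npair_val /= -(cart_rn (M := R) _ (cart_sym (cart_gcounit H f))).
  by rewrite tmap_comp_iso.
by rewrite /npair_val /= (nmap_tmap R D1) tmapM.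
Qed.

Definition sN_counit_fun X (w : sN (res_semi H R) X) : R X :=
  npair_val (sval (cid (qsetP w))).

Lemma sN_counitE X V (j : gmap V X) (u : R (gind (gres H V))) :
  sN_counit_fun (sN_class (R := res_semi H R) j u) = tmap R j (nmap R (gcounit H V) u).
Proof.
rewrite /sN_counit_fun; case: cid => P /= /sNP PQ.
by rewrite -(npair_val_equiv PQ).
Qed.

Definition sN_counit : smorph (sN_semi S) R.
Proof.
refine (@SMorph G (sN_semi S) R sN_counit_fun _ _ _) => X Y f w;
  have [V [j [u ->]]] := sN_surj w.
- have [V' [j' [k C]]] := cart_exists f j.
  rewrite [rmap _ _ _](rmap_sN S _ ((cartP _ _ _ _).2 C)) !sN_counitE (cart_rt _ C).
  by rewrite (cart_rn _ (cart_sym (cart_gcounit H k))).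
- by rewrite [tmap _ _ _](tmap_sN S) !sN_counitE tmapM.
have [E [D [e [k [p D1]]]]] := dist_exists j f.
rewrite [nmap _ _ _](nmap_sN S _ ((distP _ _ _ _ _).2 D1)) !sN_counitE (dist_nt _ D1).
rewrite (cart_rn _ (cart_sym (cart_gcounit H e))) -!nmapM; congr (tmap R _ (nmap R _ _)).
by apply: gmapP => x; exact: (cart_comm (cart_gcounit H k)).
Defined.
End SemiNormCounit.

Section Adjunction.
Variables (G : finGroupType) (H : {group G}).
Variable S : forall R : semi_tambara (subg_of H), sN_structure R.
Variable K : forall M : semi_tambara G, completion_structure M.

Definition norm_map (R R' : tambara_cat (subg_of H)) (phi : smorph R R') :
    smorph (tambara_norm S K R) (tambara_norm S K R') :=
  extend (K (sN_semi (S R))) (R := tambara_norm S K R')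
    (smorphM (to_completion (K (sN_semi (S R')))) (sN_map (S R) (S R') phi)).

Lemma norm_mapE (R R' : tambara (subg_of H)) (phi : smorph R R')
    (X V : gset G) (j : gmap V X) (u : R (gres H V)) :
  norm_map phi X (tambara_norm_class S K R j u)
    = tambara_norm_class S K R' j (phi (gres H V) u).
Proof. by rewrite /norm_map [LHS]extend_to_gr /= sN_mapE. Qed.

Lemma norm_ext (R : tambara (subg_of H)) (R' : tambara G)
    (psi psi' : smorph (tambara_norm S K R) R') :
  (forall X V (j : gmap V X) u, psi X (tambara_norm_class S K R j u)
     = psi' X (tambara_norm_class S K R j u)) -> psi = psi'.
Proof.
move=> e; apply: completion_ext => X w; have [V [j [u ->]]] := sN_surj w.
exact: e.
Qed.

Lemma norm_map1 (R : tambara (subg_of H)) : norm_map (smorph1 R) = smorph1 (tambara_norm S K R).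
Proof. apply: norm_ext => X V j u. exact: (norm_mapE (smorph1 R) j u). Qed.

Lemma norm_mapM (R R' R'' : tambara (subg_of H)) (psi : smorph R' R'') (phi : smorph R R') :
  norm_map (smorphM psi phi) = smorphM (norm_map psi) (norm_map phi).
Proof.
apply: norm_ext => X V j u; rewrite [LHS](norm_mapE (smorphM psi phi)).
by rewrite [RHS](congr1 (norm_map psi X) (norm_mapE phi j u)) [RHS]norm_mapE.
Qed.

Definition norm_functor : functor_on (tambara_norm S K) :=
  @FunctorOn (tambara_cat (subg_of H)) (tambara_cat G) (tambara_norm S K)
    norm_map norm_map1 (fun R R' R'' psi phi => norm_mapM psi phi).

Definition norm_unit (R : tambara (subg_of H)) : smorph R (res H (tambara_norm S K R)).
Proof.
refine (@SMorph _ R (res H (tambara_norm S K R))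
  (fun X u => to_completion (K (sN_semi (S R))) _ (sN_unit (S R) X u)) _ _ _) => X Y f u.
- by rewrite smapR [LHS]smapR.
- by rewrite smapT [LHS]smapT.
- by rewrite smapN [LHS]smapN.
Defined.

Definition norm_counit (R : tambara G) : smorph (tambara_norm S K (res H R)) R :=
  extend (K (sN_semi (S (res_semi H R)))) (sN_counit (S (res_semi H R))).

Lemma norm_counitE (R : tambara G) (X V : gset G) (j : gmap V X) (u : R (gind (gres H V))) :
  norm_counit R X (tambara_norm_class S K (res H R) j u)
    = tmap R j (nmap R (gcounit H V) u).
Proof. by rewrite /norm_counit [LHS]extend_to_gr /= sN_counitE. Qed.

Lemma norm_class_tmap_nmap (R : tambara (subg_of H)) X V (j : gmap V X)
    (u : R (gres H V)) :
  tmap (tambara_norm S K R) j (nmap (tambara_norm S K R) (gcounit H V)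
    (tambara_norm_class S K R (gid (gind (gres H V))) (nmap R (gunit (gres H V)) u)))
  = tambara_norm_class S K R j u.
Proof.
set M := sN_semi (S R); rewrite -[tambara_norm_class _ _ _ _ _]/(to_completion (K M) _ _).
rewrite -smapN -smapT; congr (to_completion (K M) _ _).
rewrite [nmap _ _ _](nmap_sN (S R) _ ((distP _ _ _ _ _).2 (dist_id_l (gcounit H V)))).
rewrite [LHS](tmap_sN (S R)); apply: sN_class_eq => //.
rewrite (rmap_id (f := gres_map H (gid _))) // -nmapM nmap_id // => v.
by rewrite /= gcounit_fun_cls gact1.
Qed.

Lemma norm_unit_natural (R R' : tambara (subg_of H)) (phi : smorph R R') :
  smorphM (res_map H (norm_map phi)) (norm_unit R) = smorphM (norm_unit R') phi.
Proof.
apply: smorphP => X u; rewrite [LHS](norm_mapE phi (gid (gind X))).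
by rewrite (smapN phi).
Qed.

Lemma norm_counit_natural (R R' : tambara G) (phi : smorph R R') :
  smorphM phi (norm_counit R) = smorphM (norm_counit R') (norm_map (res_map H phi)).
Proof.
apply: norm_ext => X V j u; rewrite [LHS](congr1 (phi X) (norm_counitE j u)) smapT smapN.
apply/esym; rewrite [LHS](congr1 (norm_counit R' X) (norm_mapE (res_map H phi) j u)).
exact: norm_counitE.
Qed.

Lemma norm_triangle_left (R : tambara (subg_of H)) :
  smorphM (norm_counit (tambara_norm S K R)) (norm_map (norm_unit R)) = smorph1 _.
Proof.
apply: norm_ext => X V j u.
rewrite [LHS](congr1 (norm_counit (tambara_norm S K R) X) (norm_mapE (norm_unit R) j u)).
rewrite [LHS]norm_counitE; exact: norm_class_tmap_nmap.
Qed.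

Lemma norm_triangle_right (R : tambara G) :
  smorphM (res_map H (norm_counit R)) (norm_unit (res H R)) = smorph1 _.
Proof.
apply: smorphP => X u; rewrite [LHS](norm_counitE (R := R) (gid (gind X))) tmap1 -nmapM.
rewrite [LHS]nmap_id // => w; have [g [x ->]] := gindP w.
by rewrite [LHS](congr1 (gcounit H (gind X)) (gind_mapE (gunit X) g x)) gcounitE /= ind_act_cls mulg1.
Qed.

Lemma norm_adjunction :
  is_adjunction norm_functor (res_functor H) norm_unit norm_counit.
Proof.
split.
- exact: norm_unit_natural.
- exact: norm_counit_natural.
- exact: norm_triangle_left.
- exact: norm_triangle_right.
Qed.
End Adjunction.

(* The first two conjuncts state that sN R and the additive completions, whose
   operations are prescribed by formulas, are well defined. *)
Theorem theorem7p14 (G : finGroupType) (H : {group G}) :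
  inhabited (forall R : semi_tambara (subg_of H), sN_structure R) /\
  inhabited (forall M : semi_tambara G, completion_structure M) /\
  forall (S : forall R : semi_tambara (subg_of H), sN_structure R)
         (K : forall M : semi_tambara G, completion_structure M),
  exists (N : functor_on (tambara_norm S K))
         (eta : forall R : tambara (subg_of H), smorph R (res H (tambara_norm S K R)))
         (eps : forall R : tambara G, smorph (tambara_norm S K (res H R)) R),
  [/\ forall (R R' : tambara (subg_of H)) (phi : smorph R R')
             (X V : gset G) (j : gmap V X) (u : R (gres H V)),
        (fmap N phi : smorph (tambara_norm S K R) (tambara_norm S K R')) X
            (tambara_norm_class S K R j u)
          = tambara_norm_class S K R' j (phi (gres H V) u),
      forall (R : tambara (subg_of H)) (X : gset (subg_of H)) (u : R X),
        eta R X u = tambara_norm_class S K R (gid (gind X)) (nmap R (gunit X) u),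
      forall (R : tambara G) (X V : gset G) (j : gmap V X) (u : R (gind (gres H V))),
        eps R X (tambara_norm_class S K (res H R) j u) = tmap R j (nmap R (gcounit H V) u) &
      is_adjunction N (res_functor H) eta eps].
Proof.
split; first by split=> R; exact: sN_std.
split; first by split=> M; exact: completion_std.
move=> S K; exists (norm_functor S K), (norm_unit S K), (norm_counit S K); split=> //.
- exact: norm_mapE.
- exact: norm_counitE.
- exact: norm_adjunction.
Qed.
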